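(* Let $(M,\mathcal{T})$, $\mathcal{T}=(V,E,F)$, be a triangulated connected closed surface, let $\mathbb{G}\in\{\mathbb{E}^2,\mathbb{H}^2,\mathbb{S}^2\}$, and let $d=d(f)$, $f\in U\subseteq V^*$, be a discrete conformal structure on $(M,\mathcal{T})$ with $\mathbb{G}$ background geometry, with edge lengths $l_{ij}=d_{ij}+d_{ji}$. Then there exist $\alpha\in V^*$ and $\eta\in E^*$ with $\eta_{ij}=\eta_{ji}$ (both independent of $f$) such that the following hold. **(A)** If $\mathbb{G}=\mathbb{E}^2$, then $d=d(f)$ can be written as $$d_{ij}=\frac{\alpha_ie^{2f_i}+\eta_{ij}e^{f_i+f_j}}{l_{ij}}\quad\text{with}\quad l_{ij}^2=\alpha_ie^{2f_i}+\alpha_je^{2f_j}+2\eta_{ij}e^{f_i+f_j}.$$ **(B)** If $\mathbb{G}=\mathbb{H}^2$, then $d=d(f)$ has one of the following two forms. (b1) $$\tanh d_{ij}=\frac{\alpha_ie^{2f_i}}{\sinh l_{ij}}\sqrt{\frac{1+\alpha_je^{2f_j}}{1+\alpha_ie^{2f_i}}}+\frac{\eta_{ij}e^{f_i+f_j}}{\sinh l_{ij}}$$ with $$\cosh l_{ij}=\sqrt{(1+\alpha_ie^{2f_i})(1+\alpha_je^{2f_j})}+\eta_{ij}e^{f_i+f_j}\quad\text{for } 1+\alpha_ie^{2f_i}>0,\ 1+\alpha_je^{2f_j}>0,$$ $$\cosh l_{ij}=-\sqrt{(1+\alpha_ie^{2f_i})(1+\alpha_je^{2f_j})}+\eta_{ij}e^{f_i+f_j}\quad\text{for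 } 1+\alpha_ie^{2f_i}<0,\ 1+\alpha_je^{2f_j}<0,$$ one of these two sign conditions being satisfied. (b2) $$\tanh d_{ij}=-\frac{\sinh(f_j-f_i-C_{ij})}{\sinh l_{ij}}+\frac{\eta_{ij}e^{f_i+f_j}}{\sinh l_{ij}}\quad\text{with}\quad \cosh l_{ij}=\cosh(f_j-f_i-C_{ij})+\eta_{ij}e^{f_i+f_j},$$ where the $C_{ij}$ are constants satisfying, for every triangle $\{ijk\}\in F$, $C_{ij}+C_{jk}+C_{ki}=0$ and $C_{rs}+C_{sr}=0$ for $\{r,s\}\subseteq\{i,j,k\}$. **(C)** If $\mathbb{G}=\mathbb{S}^2$, then: When $\frac{\cos d_{ij}}{\cos d_{ji}}>0$, $d=d(f)$ has one of the following two forms. (c1) $$\tan d_{ij}=\frac{\alpha_ie^{2f_i}}{\sin l_{ij}}\sqrt{\frac{1-\alpha_je^{2f_j}}{1-\alpha_ie^{2f_i}}}+\frac{\eta_{ij}e^{f_i+f_j}}{\sin l_{ij}}$$ with $$\cos l_{ij}=\sqrt{(1-\alpha_ie^{2f_i})(1-\alpha_je^{2f_j})}-\eta_{ij}e^{f_i+f_j}\quad\text{for } 1-\alpha_ie^{2f_i}>0,\ 1-\alpha_je^{2f_j}>0,$$ $$\cos l_{ij}=-\sqrt{(1-\alpha_ie^{2f_i})(1-\alpha_je^{2f_j})}-\eta_{ij}e^{f_i+f_j}\quad\text{for } 1-\alpha_ie^{2f_i}<0,\ 1-\alpha_je^{2f_j}<0,$$ one of these two sign conditions being satisfied. (c2)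 $$\tan d_{ij}=\frac{\sinh(f_j-f_i-C_{ij})}{\sin l_{ij}}+\frac{\eta_{ij}e^{f_i+f_j}}{\sin l_{ij}}\quad\text{with}\quad \cos l_{ij}=\cosh(f_j-f_i-C_{ij})-\eta_{ij}e^{f_i+f_j},$$ where the $C_{ij}$ are constants satisfying, for every triangle $\{ijk\}\in F$, $C_{ij}+C_{jk}+C_{ki}=0$ and $C_{rs}+C_{sr}=0$ for $\{r,s\}\subseteq\{i,j,k\}$. When $\frac{\cos d_{ij}}{\cos d_{ji}}<0$, $d=d(f)$ has one of the following two forms. (c3) $$\tan d_{ij}=-\frac{\alpha_ie^{2f_i}}{\sin l_{ij}}\sqrt{\frac{1-\alpha_je^{2f_j}}{1-\alpha_ie^{2f_i}}}-\frac{\eta_{ij}e^{f_i+f_j}}{\sin l_{ij}}$$ with $$\cos l_{ij}=-\sqrt{(1-\alpha_ie^{2f_i})(1-\alpha_je^{2f_j})}+\eta_{ij}e^{f_i+f_j}\quad\text{for } 1-\alpha_ie^{2f_i}>0,\ 1-\alpha_je^{2f_j}>0,$$ $$\cos l_{ij}=\sqrt{(1-\alpha_ie^{2f_i})(1-\alpha_je^{2f_j})}+\eta_{ij}e^{f_i+f_j}\quad\text{for } 1-\alpha_ie^{2f_i}<0,\ 1-\alpha_je^{2f_j}<0,$$ one of these two sign conditions being satisfied. (c4) $$\tan d_{ij}=-\frac{\sinh(f_j-f_i-C_{ij})}{\sin l_{ij}}-\frac{\eta_{ij}e^{f_i+f_j}}{\sin l_{ij}}\quad\text{with}\quad \cos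 l_{ij}=-\cosh(f_j-f_i-C_{ij})+\eta_{ij}e^{f_i+f_j},$$ where the $C_{ij}$ are constants satisfying, for every triangle $\{ijk\}\in F$, $C_{ij}+C_{jk}+C_{ki}=0$ and $C_{rs}+C_{sr}=0$ for $\{r,s\}\subseteq\{i,j,k\}$.
   Context: **Triangulated surfaces.** $M$ is a connected closed surface with a triangulation $\mathcal{T}=(V,E,F)$, where $V,E,F$ are the sets of vertices, edges and faces and $V$ is a finite subset of $M$. A vertex, an edge and a face are denoted $v_i$ (or just $i$), $\{ij\}$ and $\{ijk\}$. $E_+$ is the set of oriented edges, written as ordered pairs $(i,j)$; each edge $\{ij\}$ gives the two oriented edges $(i,j)$ and $(j,i)$. $V^*$, $E^*$, $E_+^*$ denote the sets of real-valued functions on $V$, $E$, $E_+$ respectively; values are written with subscripts ($f_i$, $\eta_{ij}$, $d_{ij}$). **Piecewise $\mathbb{G}$ surfaces.** Let $\mathbb{G}$ be $\mathbb{E}^2$, $\mathbb{H}^2$ or $\mathbb{S}^2$ (Euclidean plane, hyperbolic plane, unit sphere). If $l:E\to(0,+\infty)$ assigns a length to every edge so that every triangle $\{ijk\}\in F$ with edge lengths $l_{ij},l_{ik},l_{jk}$ is embedded in $\mathbb{G}$ (i.e. is realized as a triangle in $\mathbb{G}$), then $(M,\mathcal{T},l)$ is called a piecewise $\mathbb{G}$ surface. **Partial edge lengths.** An element $d\in E_+^*$ is an assignment of partial edge lengths (for background geometry $\mathbb{G}$) if $l_{ij}=d_{ij}+d_{ji}$ makes $(M,\mathcal{T},l)$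 a piecewise $\mathbb{G}$ surface and if for every triangle $\{ijk\}\in F$: - $d_{ij}^2+d_{jk}^2+d_{ki}^2=d_{ji}^2+d_{kj}^2+d_{ik}^2$ if $\mathbb{G}=\mathbb{E}^2$; - $\cosh(d_{ij})\cosh(d_{jk})\cosh(d_{ki})=\cosh(d_{ji})\cosh(d_{kj})\cosh(d_{ik})$ if $\mathbb{G}=\mathbb{H}^2$; - $\cos(d_{ij})\cos(d_{jk})\cos(d_{ki})=\cos(d_{ji})\cos(d_{kj})\cos(d_{ik})$ if $\mathbb{G}=\mathbb{S}^2$. The numbers $d_{ij}$ may be negative, and in general $d_{ij}\neq d_{ji}$. **Discrete conformal structures.** A discrete conformal structure $d=d(f)$ with $\mathbb{G}$ background geometry is a smooth map from an open set $U\subseteq V^*$ to $E_+^*$ sending each function $f$ on the vertices to a set of partial edge lengths $\{d_{ij}\}$ such that, with $l_{ij}=d_{ij}+d_{ji}$, for each $(i,j)\in E_+$ and $k\in V$, - $\dfrac{\partial l_{ij}}{\partial f_i}=d_{ij}$ if $\mathbb{G}=\mathbb{E}^2$; $\quad\dfrac{\partial l_{ij}}{\partial f_i}=\tanh d_{ij}$ if $\mathbb{G}=\mathbb{H}^2$; $\quad\dfrac{\partial l_{ij}}{\partial f_i}=\tan d_{ij}$ if $\mathbb{G}=\mathbb{S}^2$; - $\dfrac{\partial d_{ij}}{\partial f_k}=0$ if $k\neq i$ and $k\neq j$. **Reading conventions.** The formulas in (A), (b1), (b2) are asserted for all oriented edges $(i,j)\in E_+$ and all $f\in U$. In (C) the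 condition on the sign of $\cos d_{ij}/\cos d_{ji}$ is a condition on the edge $\{ij\}$: the formulas in the first pair of forms concern the oriented edges for which this ratio is positive, those in the second pair concern the oriented edges for which it is negative, and different edges of the same triangle may have different signs. ''Constants $C_{ij}$'' means real numbers indexed by oriented edges $(i,j)\in E_+$ and independent of $f$.
   Formalization: The open set U is assumed connected: on a disconnected U the claim is false, since α and η independent of f need not exist (e.g. E², d_ij = d_ji = sqrt(η/2)e^{(f_i+f_j)/2} with η=1 on one ball and η=2 on a disjoint one). *)

(* Defs.v *)
From HB Require Import structures.
From mathcomp Require Export all_boot all_order all_algebra.
From mathcomp Require Export all_classical all_reals all_analysis.

Set Implicit Arguments.
Unset Strict Implicit.
Unset Printing Implicit Defensive.

Export Order.TTheory GRing.Theory Num.Theory.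
Export numFieldNormedType.Exports.

Local Open Scope classical_set_scope.
Local Open Scope ring_scope.

(* The vertices are 0, ..., n-1.  The surface enters only through the
   combinatorics of (V, E, F): a finite simplicial complex of dimension 2
   triangulates a connected closed surface when each edge lies in exactly two
   faces, each vertex link is a single cycle and the complex is connected.
   The links are 2-regular graphs by [edge_in_two_faces], so such a link is a
   single cycle when it is nonempty and connected. *)
Section Triangulation.
Context {n : nat}.

Definition link_rel (F : {set {set 'I_n}}) (i : 'I_n) : rel 'I_n :=
  fun j k => [set i; j; k]%SET \in F.

Record triangulated_closed_surface := TriangulatedClosedSurface {
  edges : {set {set 'I_n}};
  faces : {set {set 'I_n}};
  vertices_nonempty : (0 < n)%N;
  card_edge : forall e, e \in edges -> #|e| = 2%N;
  card_face : forall t, t \in faces -> #|t| = 3%N;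
  face_edges : forall (t e : {set 'I_n}),
    t \in faces -> e \subset t -> #|e| = 2%N -> e \in edges;
  edge_in_two_faces : forall e, e \in edges ->
    #|[set t in faces | e \subset t]%SET| = 2%N;
  link_nonempty : forall i, exists j, [set i; j]%SET \in edges;
  link_connected : forall i j k,
    [set i; j]%SET \in edges -> [set i; k]%SET \in edges ->
    connect (link_rel faces i) j k;
  surface_connected : forall i j,
    connect (fun a b => [set a; b]%SET \in edges) i j
}.

Definition oedge (T : triangulated_closed_surface) (i j : 'I_n) : bool :=
  [set i; j]%SET \in edges T.

Definition face (T : triangulated_closed_surface) (i j k : 'I_n) : bool :=
  [set i; j; k]%SET \in faces T.

End Triangulation.
Arguments triangulated_closed_surface n : clear implicits.

Inductive geometry := Euclidean | Hyperbolic | Spherical.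

Section HyperbolicFunctions.
Context {R : realType}.
Implicit Types x : R.

Definition cosh x : R := (expR x + expR (- x)) / 2.
Definition sinh x : R := (expR x - expR (- x)) / 2.
Definition tanh x : R := sinh x / cosh x.
Definition arcosh x : R := ln (x + Num.sqrt (x ^+ 2 - 1)).

End HyperbolicFunctions.

(* The Euclidean plane is R^2, the hyperbolic plane is the upper sheet of the
   hyperboloid in R^{1,2}, the sphere is the unit sphere of R^3. *)
Section ModelGeometries.
Context {R : realType}.

Definition dot m (u v : 'rV[R]_m) : R := \sum_(a < m) u 0 a * v 0 a.

Definition minkowski (u v : 'rV[R]_3) : R :=
  - (u 0 ord0 * v 0 ord0) + \sum_(a < 2) u 0 (lift ord0 a) * v 0 (lift ord0 a).

Definition Edist (p q : 'rV[R]_2) : R := Num.sqrt (dot (p - q) (p - q)).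
Definition Hdist (u v : 'rV[R]_3) : R := arcosh (- minkowski u v).
Definition Sdist (u v : 'rV[R]_3) : R := acos (dot u v).

Definition on_hyperboloid (u : 'rV[R]_3) : Prop :=
  minkowski u u = -1 /\ 0 < u 0 ord0.
Definition on_sphere (u : 'rV[R]_3) : Prop := dot u u = 1.

(* Rank conditions: the three vertices do not lie on a common geodesic. *)
Definition embedded_triangle (G : geometry) (a b c : R) : Prop :=
  match G with
  | Euclidean => exists p q r : 'rV[R]_2,
      [/\ \rank (col_mx (q - p) (r - p)) = 2%N,
          Edist p q = a, Edist q r = b & Edist r p = c]
  | Hyperbolic => exists p q r : 'rV[R]_3,
      [/\ on_hyperboloid p, on_hyperboloid q & on_hyperboloid r] /\
      [/\ \rank (col_mx p (col_mx q r)) = 3%N,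
          Hdist p q = a, Hdist q r = b & Hdist r p = c]
  | Spherical => exists p q r : 'rV[R]_3,
      [/\ on_sphere p, on_sphere q & on_sphere r] /\
      [/\ \rank (col_mx p (col_mx q r)) = 3%N,
          Sdist p q = a, Sdist q r = b & Sdist r p = c]
  end.

End ModelGeometries.

Section DiscreteConformal.
Context {R : realType} {n : nat}.
Implicit Types (T : triangulated_closed_surface n) (G : geometry).

(* Functions on E and on E_+ are encoded as functions of two vertices, of which
   only the values at the pairs with [oedge T i j] matter. *)

Definition piecewise_surface G T (l : 'I_n -> 'I_n -> R) : Prop :=
  (forall i j, oedge T i j -> l i j = l j i /\ 0 < l i j) /\
  (forall i j k, face T i j k -> embedded_triangle G (l i j) (l j k) (l k i)).

Definition edge_length (d : 'I_n -> 'I_n -> R) (i j : 'I_n) : R :=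
  d i j + d j i.

Definition partial_edge_lengths G T (d : 'I_n -> 'I_n -> R) : Prop :=
  piecewise_surface G T (edge_length d) /\
  forall i j k, face T i j k ->
    match G with
    | Euclidean => d i j ^+ 2 + d j k ^+ 2 + d k i ^+ 2 =
                   d j i ^+ 2 + d k j ^+ 2 + d i k ^+ 2
    | Hyperbolic => cosh (d i j) * cosh (d j k) * cosh (d k i) =
                    cosh (d j i) * cosh (d k j) * cosh (d i k)
    | Spherical => cos (d i j) * cos (d j k) * cos (d k i) =
                   cos (d j i) * cos (d k j) * cos (d i k)
    end.

(* A function f on V is the row vector with entries f 0 i, so that V^* carries
   the topology of R^n. *)

Definition partial (k : 'I_n) (g : 'rV[R]_n -> R) : 'rV[R]_n -> R :=
  fun f => 'D_(delta_mx 0 k : 'rV[R]_n) g f.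

Definition iter_partial (s : seq 'I_n) (g : 'rV[R]_n -> R) : 'rV[R]_n -> R :=
  foldr partial g s.

(* C^oo on the open set U: all iterated partial derivatives exist and are
   continuous at the points of U. *)
Definition smooth_on (U : set 'rV[R]_n) (g : 'rV[R]_n -> R) : Prop :=
  forall (s : seq 'I_n) (f : 'rV[R]_n), U f ->
    {for f, continuous (iter_partial s g)} /\
    forall k, derivable (iter_partial s g) f (delta_mx 0 k : 'rV[R]_n).

(* In the spherical case, the condition involving tan (d i j) includes that the
   tangent is defined; in the library, tan x is 0 where cos x = 0. *)
Definition length_derivative_condition G (dl x : R) : Prop :=
  match G with
  | Euclidean => dl = x
  | Hyperbolic => dl = tanh x
  | Spherical => cos x != 0 /\ dl = tan x
  end.

Definition discrete_conformal_structure G T (U : set 'rV[R]_n)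
    (d : 'rV[R]_n -> 'I_n -> 'I_n -> R) : Prop :=
  [/\ open U,
      forall i j, oedge T i j -> smooth_on U (fun f => d f i j),
      forall f, U f -> partial_edge_lengths G T (d f),
      forall i j f, oedge T i j -> U f ->
        length_derivative_condition G
          (partial i (fun g => edge_length (d g) i j) f) (d f i j)
    & forall i j k f, oedge T i j -> U f -> k != i -> k != j ->
        partial k (fun g => d g i j) f = 0].

Implicit Types (f : 'rV[R]_n) (d : 'rV[R]_n -> 'I_n -> 'I_n -> R)
  (alpha : 'I_n -> R) (eta C : 'I_n -> 'I_n -> R) (i j : 'I_n).

Definition vterm alpha f i : R := alpha i * expR (2 * f 0 i).
Definition eterm eta f i j : R := eta i j * expR (f 0 i + f 0 j).

Definition formA alpha eta d f i j : Prop :=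
  let l := edge_length (d f) i j in
  let A := vterm alpha f in
  let H := eterm eta f i j in
  d f i j = (A i + H) / l /\ l ^+ 2 = A i + A j + 2 * H.

Definition formB1 alpha eta d f i j : Prop :=
  let l := edge_length (d f) i j in
  let A := vterm alpha f in
  let H := eterm eta f i j in
  tanh (d f i j) =
    A i / sinh l * Num.sqrt ((1 + A j) / (1 + A i)) + H / sinh l /\
  ([/\ 0 < 1 + A i, 0 < 1 + A j
     & cosh l = Num.sqrt ((1 + A i) * (1 + A j)) + H] \/
   [/\ 1 + A i < 0, 1 + A j < 0
     & cosh l = - Num.sqrt ((1 + A i) * (1 + A j)) + H]).

Definition formB2 eta C d f i j : Prop :=
  let l := edge_length (d f) i j in
  let H := eterm eta f i j in
  let u := f 0 j - f 0 i - C i j in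
  tanh (d f i j) = - (sinh u / sinh l) + H / sinh l /\
  cosh l = cosh u + H.

Definition formC1 alpha eta d f i j : Prop :=
  let l := edge_length (d f) i j in
  let A := vterm alpha f in
  let H := eterm eta f i j in
  tan (d f i j) =
    A i / sin l * Num.sqrt ((1 - A j) / (1 - A i)) + H / sin l /\
  ([/\ 0 < 1 - A i, 0 < 1 - A j
     & cos l = Num.sqrt ((1 - A i) * (1 - A j)) - H] \/
   [/\ 1 - A i < 0, 1 - A j < 0
     & cos l = - Num.sqrt ((1 - A i) * (1 - A j)) - H]).

Definition formC2 eta C d f i j : Prop :=
  let l := edge_length (d f) i j in
  let H := eterm eta f i j in
  let u := f 0 j - f 0 i - C i j in
  tan (d f i j) = sinh u / sin l + H / sin l /\
  cos l = cosh u - H.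

Definition formC3 alpha eta d f i j : Prop :=
  let l := edge_length (d f) i j in
  let A := vterm alpha f in
  let H := eterm eta f i j in
  tan (d f i j) =
    - (A i / sin l * Num.sqrt ((1 - A j) / (1 - A i))) - H / sin l /\
  ([/\ 0 < 1 - A i, 0 < 1 - A j
     & cos l = - Num.sqrt ((1 - A i) * (1 - A j)) + H] \/
   [/\ 1 - A i < 0, 1 - A j < 0
     & cos l = Num.sqrt ((1 - A i) * (1 - A j)) + H]).

Definition formC4 eta C d f i j : Prop :=
  let l := edge_length (d f) i j in
  let H := eterm eta f i j in
  let u := f 0 j - f 0 i - C i j in
  tan (d f i j) = - (sinh u / sin l) - H / sin l /\
  cos l = - cosh u + H.

Definition triangle_constants T C : Prop :=
  forall i j k, face T i j k ->
    C i j + C j k + C k i = 0 /\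
    forall r s, r \in [set i; j; k]%SET -> s \in [set i; j; k]%SET -> r != s ->
      C r s + C s r = 0.

Definition same_sign_edge d f i j : Prop := 0 < cos (d f i j) / cos (d f j i).
Definition opposite_sign_edge d f i j : Prop :=
  cos (d f i j) / cos (d f j i) < 0.

End DiscreteConformal.

(* Main.v *)
Require Import Defs.
From mathcomp Require Import ring lra.

(* Write x = d_ij, y = d_ji.  In the curved geometries put V_ij = c(y)/c(x) with
   c = cosh or cos.  The compatibility condition says that V_ij V_jk V_ki = 1
   on each face, so the logarithmic derivative of V_ij with respect to f_i is
   the same for all j in the link of i; by connectedness of the link it depends
   on i only, and by locality on f_i only.  With p_i = 1 + d(log|V_ij|)/d(f_i),
   equality of the mixed second derivatives of l_ij becomes p_j V_ij^2 = p_i.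
   Differentiating, p_i' = 2 p_i (p_i - 1).  Either p vanishes identically, and
   then V_ij = +- exp(f_j - f_i - C_ij), or p_i = 1 / (1 + A_i) with
   A_i = alpha_i exp(2 f_i).  Since d(c(l_ij))/d(f_i) = c(l_ij) - V_ij, the
   remainder c(l_ij) - (1 + A_i) V_ij (resp. c(l_ij) - (V_ij + V_ji) / 2) has
   logarithmic derivative 1 in f_i and in f_j, so it is eta_ij exp(f_i + f_j).
   In the Euclidean case x^2 - y^2 plays the role of log V_ij. *)

Set Implicit Arguments.
Unset Strict Implicit.
Unset Printing Implicit Defensive.

Local Open Scope classical_set_scope.
Local Open Scope ring_scope.

(** * Directional derivatives and connected open sets *)

Section Calculus.
Context {R : realType}.

(** Both difference quotients are the same function of the increment, so one-variable results
    transfer to directional derivatives. *)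
Lemma is_derive_lineP (V W : normedModType R) (a v : V) (g : V -> W) (s : R) l :
  is_derive (a + s *: v) v g l <-> is_derive s 1 (fun t : R => g (a + t *: v)) l.
Proof.
have E : (fun h : R => h^-1 *: ((g \o shift (a + s *: v)) (h *: v) - g (a + s *: v))) =
  (fun h : R => h^-1 *: (((fun t : R => g (a + t *: v)) \o shift s) (h *: 1) -
     g (a + s *: v))).
  by apply/funext => h; rewrite /= [h *: 1]mulr1 scalerDl (addrCA (h *: v)).
by split=> -[dg <-]; split; rewrite /derivable /derive ?E// -E.
Qed.

(** Restriction to the line through a reduces this to the one-variable chain rule, so g needs a
    derivative along v only. *)
Lemma is_derive_comp (V : normedModType R) (a v : V) (g : V -> R) (h : R -> R) dg dh :
  is_derive (g a) 1 h dh -> is_derive a v g dg ->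
  is_derive a v (fun x => h (g x)) (dh * dg).
Proof.
have aE : a = a + 0 *: v by rewrite scale0r addr0.
rewrite aE => Dh /is_derive_lineP Dg.
apply/is_derive_lineP.
exact: (@is_derive1_comp _ h (fun t => g (a + t *: v))).
Qed.

(** Two points of a ball are joined inside it by axis-parallel segments, so Z is locally constant on
    U, and connectedness does the rest. *)
Lemma coord_segment_ind n (U : set 'rV[R]_n) (Z : 'rV[R]_n -> Prop) :
  open U -> connected U ->
  (forall k f (t : R), (forall s : R, 0 <= s <= 1 -> U (f + (s * t) *: delta_mx 0 k)) ->
     Z f -> Z (f + t *: delta_mx 0 k)) ->
  forall f0 f, U f0 -> U f -> Z f0 -> Z f.
Proof.
move=> Uo Uc Zs f0 f Uf0 Uf Zf0.
have box g : U g -> exists2 e : R, 0 < e &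
    ball g e `<=` U /\ forall g1 g2, ball g e g1 -> ball g e g2 -> Z g1 -> Z g2.
  move=> Ug; have /nbhs_ballP[e /= e0 eU] : nbhs g U by exact: open_nbhs_nbhs.
  exists e => //; split=> // g1 g2 [_ b1] [_ b2] Z1.
  (* [h m] has its first m coordinates from g2 and the others from g1: consecutive points differ by
     one axis-parallel segment. *)
  pose h m : 'rV[R]_n := \row_k if (k < m)%N then g2 0 k else g1 0 k.
  have Zh m : Z (h m).
    elim: m => [|m IHm].
      by rewrite (_ : h 0%N = g1)//; apply/rowP => k; rewrite mxE.
    have [mn|nm] := ltnP m n; last first.
      rewrite (_ : h m.+1 = h m)//; apply/rowP => k; rewrite !mxE.
      by rewrite !(leq_trans (ltn_ord k)) // (leq_trans nm).
    pose k := Ordinal mn.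
    have -> : h m.+1 = h m + (g2 0 k - g1 0 k) *: delta_mx 0 k.
      apply/rowP => j; rewrite !mxE eqxx /= ltnS leq_eqVlt -[j == k]/(j == m :> nat).
      have [jm|jm] /= := eqVneq (j : nat) m.
        have -> : j = k by exact: val_inj.
        by rewrite ltnn; ring.
      by rewrite mulr0 addr0.
    apply: Zs => // s /andP[s0 s1]; apply: eU; split => // a j.
    rewrite (ord1 a) !mxE eqxx /= -[j == k]/(j == m :> nat).
    have := b1 0 j; have := b2 0 j; rewrite /ball/=.
    have [jm|jm] /= := eqVneq (j : nat) m; last first.
      by rewrite mulr0 addr0; case: ifP.
    have -> : j = k by exact: val_inj.
    rewrite ltnn mulr1 !ltr_norml => /andP[H3 H4] /andP[H1 H2].
    (* Convex combinations of positive numbers are positive; applied to the distances to both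
       bounds, this keeps the segment in the sup-norm ball. *)
    have conv (P Q : R) : 0 < P -> 0 < Q -> 0 < P + s * (Q - P).
      by case: (leP P Q) => PQ P0 Q0; nra.
    have := conv _ _ (etrans (subr_gt0 _ _) H1) (etrans (subr_gt0 _ _) H3).
    have := conv _ _ (etrans (subr_gt0 _ _) H2) (etrans (subr_gt0 _ _) H4).
    by move=> ? ?; apply/andP; split; lra.
  suff -> : g2 = h n by [].
  by apply/rowP => k; rewrite mxE ltn_ord.
(* The part of U where Z holds is nonempty, open and closed in U. *)
suff E : [set x | U x /\ Z x] = U by move: Uf; rewrite -E => -[].
apply: Uc; first by exists f0.
- exists [set x | U x /\ Z x].
    rewrite openE => g [Ug Zg]; have [e e0 [eU eZ]] := box g Ug.
    apply/nbhs_ballP; exists e => // h gh; split; first exact: eU.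
    by apply: eZ gh Zg; exact: ballxx.
  by apply/seteqP; split => x /=; tauto.
- exists (~` [set x | U x /\ ~ Z x]).
    apply: open_closedC; rewrite openE => g [Ug Zg].
    have [e e0 [eU eZ]] := box g Ug.
    apply/nbhs_ballP; exists e => // h gh; split; first exact: eU.
    by move=> Zh; apply: Zg; apply: eZ gh _ Zh; exact: ballxx.
  by apply/seteqP; split => x /=; [tauto|move=> [Ux /not_andP[//|/contrapT]]].
Qed.

(** The mean value theorem on [0, 1] in the parameter s, so that t may have either sign. *)
Lemma eq_segment n (a e : 'rV[R]_n) (g : 'rV[R]_n -> R) (t : R) :
  (forall s : R, 0 <= s <= 1 -> is_derive (a + (s * t) *: e) e g 0) ->
  g (a + t *: e) = g a.
Proof.
move=> dg.
have It (s : R) : is_derive s 1 (fun s : R => s * t) t.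
  by apply: is_derive_eq; rewrite scaler0 add0r /GRing.scale /= mulr1.
have dG (s : R) : 0 <= s <= 1 -> is_derive s 1 (fun s : R => g (a + (s * t) *: e)) 0.
  move=> s01; have D : is_derive (s * t) 1 (fun u : R => g (a + u *: e)) 0.
    exact/(is_derive_lineP a e g (s * t) 0)/dg.
  rewrite -(mul0r t).
  exact: (@is_derive1_comp R (fun u : R => g (a + u *: e)) (fun s : R => s * t)).
have [|||c _] := @MVT_segment R (fun s : R => g (a + (s * t) *: e)) (fun=> 0) 0 1.
- by [].
- by move=> s; rewrite in_itv /= => /andP[s0 s1]; apply: dG; rewrite !ltW.
- apply: continuous_in_subspaceT => s; rewrite inE/= in_itv/= => s01.
  apply: differentiable_continuous; apply/derivable1_diffP.
  by have [] := dG _ s01.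
- by rewrite !mul0r mul1r scale0r addr0 => /eqP; rewrite subr_eq0 => /eqP.
Qed.

Lemma zero_partials_cst n (U : set 'rV[R]_n) (g : 'rV[R]_n -> R) :
  open U -> connected U ->
  (forall f k, U f -> is_derive f (delta_mx 0 k : 'rV[R]_n) g 0) ->
  exists c, forall f, U f -> g f = c.
Proof.
move=> Uo Uc dg; have [[f0 Uf0]|U0] := pselect (exists f, U f); last first.
  by exists 0 => f Uf; case: U0; exists f.
exists (g f0) => f Uf.
apply: (coord_segment_ind (Z := fun f => g f = g f0)) Uf0 Uf _ => //.
by move=> k h t hU <-; apply: eq_segment => s /hU; exact: dg.
Qed.

(** All partial derivatives of g exp(-u) vanish. Every constant of the classification is obtained by
    this integration. *)
Lemma exp_solution n (U : set 'rV[R]_n) (g u : 'rV[R]_n -> R) (du : 'I_n -> 'rV[R]_n -> R) :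
  open U -> connected U ->
  (forall f k, U f -> is_derive f (delta_mx 0 k : 'rV[R]_n) u (du k f)) ->
  (forall f k, U f -> is_derive f (delta_mx 0 k : 'rV[R]_n) g (g f * du k f)) ->
  exists c, forall f, U f -> g f = c * expR (u f).
Proof.
move=> Uo Uc Du Dg.
have [|c gc] := @zero_partials_cst n U (fun f => g f * expR (- u f)) Uo Uc.
  move=> f k Uf.
  have De := @is_derive_comp _ f 'e_k (fun x => - u x) expR _ _
    (is_derive_expR (- u f)) (is_deriveN (Du f k Uf)).
  apply: is_derive_eq (is_deriveM (Dg f k Uf) De) _.
  by rewrite /GRing.scale /=; ring.
by exists c => f Uf; rewrite -(gc f Uf) -mulrA -expRD addNr expR0 mulr1.
Qed.

Lemma is_derive_coord n (f : 'rV[R]_n) i k :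
  is_derive f (delta_mx 0 k : 'rV[R]_n) (fun g : 'rV[R]_n => g 0 i) (i == k)%:R.
Proof.
have fE : f = f + 0 *: delta_mx 0 k by rewrite scale0r addr0.
rewrite {1}fE; apply/is_derive_lineP.
rewrite (_ : (fun t => _) = cst (f 0 i) + (i == k)%:R \*: id); last first.
  by apply/funext => t; rewrite !mxE /= mulrC.
by apply: is_derive_eq; rewrite add0r /GRing.scale /= mulr1.
Qed.

Lemma MVT_line (V : normedModType R) (a v : V) (g : V -> R) (dg : R -> R) (h : R) :
  0 <= h ->
  (forall s : R, 0 <= s <= h -> is_derive (a + s *: v) v g (dg s)) ->
  exists2 s : R, 0 <= s <= h & g (a + h *: v) - g a = dg s * h.
Proof.
move=> h0 Dg.
have dG (s : R) : 0 <= s <= h -> is_derive s 1 (fun s : R => g (a + s *: v)) (dg s).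
  by move=> /Dg /(is_derive_lineP a v g s (dg s)).
have [|||c] := @MVT_segment R (fun s : R => g (a + s *: v)) dg 0 h.
- by [].
- by move=> s; rewrite in_itv /= => /andP[s0 s1]; apply: dG; rewrite !ltW.
- apply: continuous_in_subspaceT => s; rewrite inE/= in_itv/= => s01.
  apply: differentiable_continuous; apply/derivable1_diffP.
  by have [] := dG _ s01.
- by rewrite in_itv /= scale0r addr0 subr0 => ? ?; exists c.
Qed.

(** The mean value theorem is applied along u to x |-> g(x + h v) - g(x), then along v to [gu]. *)
Lemma mixed_difference (V : normedModType R) (a u v : V) (g gu guv : V -> R) (h : R) :
  0 <= h ->
  (forall s t : R, 0 <= s <= h -> 0 <= t <= h ->
    is_derive (a + s *: u + t *: v) u g (gu (a + s *: u + t *: v)) /\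
    is_derive (a + s *: u + t *: v) v gu (guv (a + s *: u + t *: v))) ->
  exists s t : R, [/\ 0 <= s <= h, 0 <= t <= h &
    g (a + h *: u + h *: v) - g (a + h *: u) - g (a + h *: v) + g a =
    guv (a + s *: u + t *: v) * h * h].
Proof.
move=> h0 D.
have D0 (s : R) : 0 <= s <= h -> is_derive (a + s *: u) u g (gu (a + s *: u)).
  move=> sh; have [|+ _] := D s 0 sh; first by rewrite lexx h0.
  by rewrite scale0r addr0.
have Dh (s : R) : 0 <= s <= h ->
    is_derive (a + s *: u) u (fun x => g (x + h *: v)) (gu (a + s *: u + h *: v)).
  move=> sh; have [|+ _] := D s h sh; first by rewrite lexx h0.
  rewrite addrAC => /(is_derive_lineP (a + h *: v) u g s) E.
  apply/(is_derive_lineP a u (fun x => g (x + h *: v)) s).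
  rewrite (_ : (fun t : R => _) = (fun t : R => g (a + h *: v + t *: u))).
    exact: E.
  by apply/funext => t; rewrite addrAC.
have [s sh Es] := @MVT_line _ a u (fun x => g (x + h *: v) - g x)
  (fun s => gu (a + s *: u + h *: v) - gu (a + s *: u)) _ h0
  (fun s sh => is_deriveB (Dh s sh) (D0 s sh)).
have [t th Et] := @MVT_line _ (a + s *: u) v gu (fun t => guv (a + s *: u + t *: v)) _ h0
  (fun t th => (D s t sh th).2).
exists s, t; split => //; rewrite -Et -Es.
rewrite -[RHS]/((g (a + h *: u + h *: v) - g (a + h *: u)) - (g (a + h *: v) - g a)).
by ring.
Qed.

(** The second difference over a small square is h^2 times either mixed derivative at some point of
    the square; continuity at f forces equality. *)
Lemma schwarz n (U : set 'rV[R]_n) i j (g gi gj gij gji : 'rV[R]_n -> R) :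
  open U ->
  (forall f, U f -> is_derive f (delta_mx 0 i : 'rV[R]_n) g (gi f)) ->
  (forall f, U f -> is_derive f (delta_mx 0 j : 'rV[R]_n) g (gj f)) ->
  (forall f, U f -> is_derive f (delta_mx 0 j : 'rV[R]_n) gi (gij f)) ->
  (forall f, U f -> is_derive f (delta_mx 0 i : 'rV[R]_n) gj (gji f)) ->
  forall f, U f -> {for f, continuous gij} -> {for f, continuous gji} ->
  gij f = gji f.
Proof.
move=> Uo Di Dj Dij Dji f Uf cij cji.
apply/eqP/negPn/negP => neq.
(* With r half the gap, the r-balls around the two values are disjoint. *)
pose r := `|gij f - gji f| / 2.
have r0 : 0 < r by rewrite divr_gt0// normr_gt0 subr_eq0.
have : \forall x \near f, [/\ U x, ball (gij f) r (gij x) & ball (gji f) r (gji x)].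
  near=> x; split.
  - near: x; exact: open_nbhs_nbhs.
  - near: x; apply: cij; exact: nbhsx_ballx.
  - near: x; apply: cji; exact: nbhsx_ballx.
move=> /nbhs_ballP[e /= e0 eU].
(* Two steps of length at most e / 3 stay in the ball of radius e even when i = j. *)
pose h := e / 3; have h0 : 0 <= h by rewrite divr_ge0 ?ltW.
have P (s t : R) : 0 <= s <= h -> 0 <= t <= h -> ball f e
   (f + s *: (delta_mx 0 i : 'rV[R]_n) + t *: (delta_mx 0 j : 'rV[R]_n)).
  move=> /andP[s0 sh] /andP[t0 th]; split=> // a k.
  rewrite /ball /= !mxE !(ord1 a) eqxx /=.
  have := ler0n R (k == i); have := lern1 R (k == i); have := ler0n R (k == j).
  have := lern1 R (k == j); rewrite !leq_b1 => j1 j0 i1 i0.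
  by rewrite ltr_norml; apply/andP; split; rewrite /h in sh th; nra.
have [s1 [t1 [sh1 th1 E1]]] := mixed_difference (gu := gi) (guv := gij) h0
  (fun s t sh th => let: And3 Ux _ _ := eU _ (P s t sh th) in conj (Di _ Ux) (Dij _ Ux)).
have P' (s t : R) : 0 <= s <= h -> 0 <= t <= h -> ball f e
   (f + s *: (delta_mx 0 j : 'rV[R]_n) + t *: (delta_mx 0 i : 'rV[R]_n)).
  by move=> sh' th'; rewrite addrAC; exact: P.
have [s' [t' [sh' th' E2]]] := mixed_difference (gu := gj) (guv := gji) h0
  (fun s t sh th => let: And3 Ux _ _ := eU _ (P' s t sh th) in conj (Dj _ Ux) (Dji _ Ux)).
have [_ b1 _] := eU _ (P s1 t1 sh1 th1); have [_ _ b2] := eU _ (P' s' t' sh' th').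
move: E1 E2 b1 b2; set A := gij (_ + _ + _); set B := gji (_ + _ + _).
rewrite (addrAC f (h *: delta_mx 0 j)) => E1 E2 b1 b2.
have AB : A = B.
  have hn0 : h != 0 by rewrite mulf_neq0 ?gt_eqF.
  do 2 apply: (mulIf hn0); rewrite -E1 -E2; ring.
move: b1 b2; rewrite AB /ball /= => b1 b2.
have := ler_normD (gij f - B) (B - gji f).
rewrite (_ : gij f - B + (B - gji f) = gij f - gji f); last ring.
rewrite leNgt => /negP; apply.
rewrite (_ : `|gij f - gji f| = r + r); last by rewrite /r; lra.
by apply: ltrD; rewrite // distrC.
Unshelve. all: by end_near. Qed.

End Calculus.

(** * Combinatorics of triangulated surfaces *)

Section Surface.
Context {n : nat} (T : triangulated_closed_surface n).
Implicit Types i j k : 'I_n.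

Lemma oedgeC i j : oedge T i j = oedge T j i.
Proof. by rewrite /oedge finset.setUC. Qed.

Lemma oedge_neq i j : oedge T i j -> i != j.
Proof. by move=> /card_edge; rewrite cards2; case: eqP. Qed.

Lemma face_oedge i j k : face T i j k -> oedge T i j /\ i != j.
Proof.
move=> ijk; have ij : i != j.
  apply/eqP => ij; have := card_face ijk; rewrite ij finset.setUid.
  by rewrite cards2; case: eqP.
split=> //; apply: (face_edges ijk); last by rewrite cards2 ij.
exact: finset.subsetUl.
Qed.

Lemma face_rot i j k : face T i j k -> face T j k i.
Proof. by rewrite /face -finset.setUA finset.setUC. Qed.

Lemma face_swap i j k : face T i j k -> face T i k j.
Proof. by rewrite /face -!finset.setUA [([set j] :|: [set k])%SET]finset.setUC. Qed.

Lemma face_third_neq i j k : face T i j k -> [/\ i != j, j != k & k != i].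
Proof.
move=> ijk; have [_ ?] := face_oedge ijk.
have [_ ?] := face_oedge (face_rot ijk).
by have [_ ?] := face_oedge (face_rot (face_rot ijk)).
Qed.

Lemma oedge_face i j : oedge T i j -> exists k, face T i j k.
Proof.
move=> ij; have /card_gt0P[t] : (0 < #|[set t in faces T | [set i; j] \subset t]%SET|)%N.
  by rewrite edge_in_two_faces.
rewrite finset.inE => /andP[tF ijt].
have : (0 < #|t :\: [set i; j]%SET|)%N.
  rewrite cardsD (finset.setIidPr ijt) (card_face tF) cards2.
  by case: (i != j).
move=> /card_gt0P[k]; rewrite !finset.inE negb_or => /andP[/andP[ki kj] kt].
exists k; rewrite /face (_ : _ :|: _ = t)%SET//.
apply/eqP; rewrite eqEcard; apply/andP; split.
  by rewrite finset.subUset ijt finset.sub1set.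
rewrite (card_face tF) finset.setUC cardsU1 !finset.inE negb_or ki kj cards2.
by rewrite (oedge_neq ij).
Qed.

(** Consecutive vertices of the link of i span a face with i, so g i is constant along the path
    given by [link_connected]. *)
Lemma link_const (A : Type) (g : 'I_n -> 'I_n -> A) :
  (forall i j k, face T i j k -> g i j = g i k) ->
  forall i j k, oedge T i j -> oedge T i k -> g i j = g i k.
Proof.
move=> gE i j k ij ik; have /connectP[s] := link_connected ij ik.
move=> + ->; elim: s j {ij} => //= a s IHs j /andP[ija /IHs <-].
exact: gE.
Qed.

Lemma vertex_neighbor : exists nb : 'I_n -> 'I_n, forall i, oedge T i (nb i).
Proof. by have [nb nbP] := boolp.choice (link_nonempty T); exists nb. Qed.

(** If the first neighbor found is m, the third vertex of a face on that edge serves. This allows a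
    quantity at i to be computed on an edge avoiding m. *)
Lemma vertex_neighbor_neq i m : exists2 j, oedge T i j & j != m.
Proof.
have [j ij] := link_nonempty T i; have [k ijk] := oedge_face ij.
have [jm|jm] := eqVneq j m; last by exists j.
exists k; first by have [] := face_oedge (face_swap ijk).
by have [_ + _] := face_third_neq ijk; rewrite jm eq_sym.
Qed.

Lemma surface_ind (P : 'I_n -> Prop) :
  (forall i j, oedge T i j -> P i -> P j) -> forall i j, P i -> P j.
Proof.
move=> Pe i j; have /connectP[s] := surface_connected T i j.
move=> + ->; elim: s i => //= a s IHs i /andP[ia /IHs Ps] Pi.
by apply: Ps; apply: Pe Pi.
Qed.

End Surface.

(** * Differentiation rules for real-valued functions, in pointwise form *)

Section PointwiseRules.
Context {R : realType} {V : normedModType R}.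
Implicit Types (a v : V) (f g : V -> R).

Lemma is_derive_ptD a v f g df dg : is_derive a v f df -> is_derive a v g dg ->
  is_derive a v (fun x => f x + g x) (df + dg).
Proof. exact: is_deriveD. Qed.

Lemma is_derive_ptB a v f g df dg : is_derive a v f df -> is_derive a v g dg ->
  is_derive a v (fun x => f x - g x) (df - dg).
Proof. exact: is_deriveB. Qed.

Lemma is_derive_ptM a v f g df dg : is_derive a v f df -> is_derive a v g dg ->
  is_derive a v (fun x => f x * g x) (df * g a + f a * dg).
Proof.
move=> Df Dg; apply: is_derive_eq (is_deriveM Df Dg) _.
by rewrite /GRing.scale /= addrC (mulrC df).
Qed.

Lemma is_derive_pt_cst a v (c : R) : is_derive a v (fun=> c) 0.
Proof. exact: is_derive_cst. Qed.

Lemma is_derive_ptZ a v c f df : is_derive a v f df ->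
  is_derive a v (fun x => c * f x) (c * df).
Proof.
by move=> /(is_derive_ptM (is_derive_pt_cst a v c)); rewrite mul0r add0r.
Qed.

Lemma is_derive_ptV a v f df : f a != 0 -> is_derive a v f df ->
  is_derive a v (fun x => (f x)^-1) (- df / f a ^+ 2).
Proof.
move=> fa0 [Df dfE]; split; first exact: derivableV.
by rewrite deriveV // dfE /GRing.scale /= mulNr mulrC mulNr.
Qed.

Lemma is_derive_uniq a v f l1 l2 :
  is_derive a v f l1 -> is_derive a v f l2 -> l1 = l2.
Proof. by move=> [_ <-] [_ <-]. Qed.

Lemma is_derive_eq_on (U : set V) a v f g l : open U -> U a ->
  (forall x, U x -> f x = g x) -> is_derive a v f l -> is_derive a v g l.
Proof.
move=> Uo Ua fg; apply: near_eq_is_derive.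
by near=> x; apply: fg; near: x; exact: open_nbhs_nbhs.
Unshelve. all: by end_near. Qed.

End PointwiseRules.

(** The sign is locally constant away from 0; this serves to show that the sign of V_ij does not
    depend on f. *)
Lemma is_derive_sgr {R : realType} (x : R) : x != 0 -> is_derive x 1 (@Num.sg R) 0.
Proof.
move=> x0; apply: near_eq_is_derive (is_derive_cst (Num.sg x) x (1 : R)).
have [xlt|xgt|//] := ltgtP x 0; last by move/eqP in x0.
  near=> y; rewrite /cst !ltr0_sg //; near: y; exact: lt_nbhsl.
near=> y; rewrite /cst !gtr0_sg //; near: y; exact: lt_nbhsr.
Unshelve. all: by end_near. Qed.

(** * The cocycle V and its logarithmic derivatives *)

Section Core.
Context {R : realType} {n : nat} (T : triangulated_closed_surface n).
Context (U : set 'rV[R]_n) (Uo : open U) (Uc : connected U).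
(** In the application V is [cratio], K is c of the edge length and p_i is 1 + sigma [phi]_ij for
    any neighbor j of i. *)
Context (V K : 'rV[R]_n -> 'I_n -> 'I_n -> R) (p : 'rV[R]_n -> 'I_n -> R).

Hypothesis V_inv : forall f i j, U f -> oedge T i j -> V f i j * V f j i = 1.
Hypothesis V_face : forall f i j k, U f -> face T i j k ->
  V f i j * V f j k * V f k i = 1.
Hypothesis K_sym : forall f i j, K f i j = K f j i.
Hypothesis DV : forall f i j k, U f -> oedge T i j ->
  is_derive f 'e_k (fun g => V g i j)
    (V f i j * ((i == k)%:R * (p f i - 1) - (j == k)%:R * (p f j - 1))).
Hypothesis Dp : forall f i k, U f -> i != k -> is_derive f 'e_k (p ^~ i) 0.
Hypothesis pV : forall f i j, U f -> oedge T i j -> p f j * V f i j ^+ 2 = p f i.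
Hypothesis DK : forall f i j k, U f -> oedge T i j ->
  is_derive f 'e_k (fun g => K g i j)
    ((i == k)%:R * (K f i j - V f i j) + (j == k)%:R * (K f i j - V f j i)).

Lemma V_neq0 f i j : U f -> oedge T i j -> V f i j != 0.
Proof.
move=> Uf ij; apply/eqP => V0; have := V_inv Uf ij.
by rewrite V0 mul0r => /eqP; rewrite eq_sym oner_eq0.
Qed.

(** At fixed f, [pV] carries a zero along edges to every vertex. When f moves in direction k, the
    p_i with i != k are constant, and p_k is recovered from a neighbor by [pV]. *)
Lemma p_zero_everywhere f0 i0 : U f0 -> p f0 i0 = 0 ->
  forall f i, U f -> p f i = 0.
Proof.
move=> Uf0 p0 f + Uf.
have step g i j : U g -> oedge T i j -> p g i = 0 -> p g j = 0.
  by move=> Ug; rewrite oedgeC => ij pi; rewrite -(pV Ug ij) pi mul0r.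
apply: (coord_segment_ind (Z := fun f => forall i, p f i = 0) Uo Uc _ Uf0 Uf).
  move=> k g t gU pg.
  have pg' i : i != k -> p (g + t *: 'e_k) i = 0.
    move=> ik; rewrite -(pg i); apply: (@eq_segment _ _ g 'e_k (p ^~ i)) => s s01.
    by apply: Dp => //; exact: gU.
  move=> i; have [ik|/pg'//] := eqVneq i k.
  have [j ij jk] := vertex_neighbor_neq T i k.
  have Ug : U (g + t *: 'e_k) by have := gU 1; rewrite mul1r; apply; rewrite ler01 lexx.
  by rewrite -(pV Ug ij) pg' // mul0r.
by move=> i; apply: (surface_ind (P := fun i => p f0 i = 0) (T := T)) p0 => a b; exact: step.
Qed.

(** Differentiability of p_i in f_i is not assumed: the derivative is read off p_j V_ij^2, where p_j
    does not depend on f_i. *)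
Lemma D_p f i k : U f ->
  is_derive f 'e_k (p ^~ i) ((i == k)%:R * (2 * p f i * (p f i - 1))).
Proof.
move=> Uf; have [<-|ik] := eqVneq i k; last by rewrite mul0r; exact: Dp.
have [j ij] := link_nonempty T i.
apply: (is_derive_eq_on (f := fun g => p g j * (V g i j * V g i j)) Uo Uf).
  by move=> g Ug; rewrite -expr2 (pV Ug ij).
have ji : j != i by rewrite eq_sym (oedge_neq ij).
have DVi := DV i Uf ij.
apply: is_derive_eq (is_derive_ptM (Dp Uf ji) (is_derive_ptM DVi DVi)) _.
by rewrite eqxx (negbTE ji) -(pV Uf ij) /=; ring.
Qed.

(** The reciprocal r = 1 / p_i satisfies the linear equation r' = 2 (r - 1), whence r - 1 = alpha_i
    exp(2 f_i). *)
Lemma core_nondegenerate : (forall f i, U f -> p f i != 0) ->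
  exists (alpha : 'I_n -> R) (eta : 'I_n -> 'I_n -> R),
    (forall i j, oedge T i j -> eta i j = eta j i) /\
    forall f i j, U f -> oedge T i j ->
      [/\ p f i * (1 + vterm alpha f i) = 1, p f j * (1 + vterm alpha f j) = 1 &
         K f i j = (1 + vterm alpha f i) * V f i j + eterm eta f i j].
Proof.
move=> p0.
have Dr f i k : U f -> is_derive f 'e_k (fun g => (p g i)^-1)
    ((i == k)%:R * (2 * ((p f i)^-1 - 1))).
  move=> Uf; apply: is_derive_eq (is_derive_ptV (p0 f i Uf) (D_p i k Uf)) _.
  by field; exact: p0.
have /boolp.choice[alpha alphaE] i : exists a, forall f, U f -> (p f i)^-1 - 1 = a * expR (2 * f 0 i).
  apply: (exp_solution (du := fun k f => 2 * (i == k)%:R) Uo Uc) => f k Uf.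
    exact: is_derive_ptZ (is_derive_coord f i k).
  apply: is_derive_eq (is_derive_ptB (Dr f i k Uf) (is_derive_pt_cst f 'e_k 1)) _.
  by ring.
(* The edge condition sits under the existential, so that choice yields a total function; the value
   off the edges is 0. *)
have etaP i j : exists e, oedge T i j -> forall f, U f ->
    K f i j - (p f i)^-1 * V f i j = e * expR (f 0 i + f 0 j).
  have [ij|_] := boolP (oedge T i j); last by exists 0.
  suff [e eE] : exists e, forall f, U f ->
    K f i j - (p f i)^-1 * V f i j = e * expR (f 0 i + f 0 j) by exists e.
  apply: (exp_solution (du := fun k f => (i == k)%:R + (j == k)%:R) Uo Uc) => f k Uf.
    exact: is_derive_ptD (is_derive_coord f i k) (is_derive_coord f j k).
  apply: is_derive_eq (is_derive_ptB (DK k Uf ij) (is_derive_ptM (Dr f i k Uf) (DV k Uf ij))) _.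
  have pi0 := p0 _ i Uf; have pj0 := p0 _ j Uf; have Vn0 := V_neq0 Uf ij.
  have -> : V f j i = (V f i j)^-1.
    by apply: (mulfI Vn0); rewrite V_inv // divff.
  rewrite -(pV Uf ij); field.
  by rewrite pj0 Vn0.
have [eta etaE] := boolp.choice (fun ij : 'I_n * 'I_n => etaP ij.1 ij.2).
(* Symmetry of eta is tested at a point of U; if U is empty, eta = 0 serves. *)
have [[f0 Uf0]|U0] := pselect (exists f, U f); last first.
  exists alpha, (fun _ _ => 0); split => // f i j Uf.
  by case: U0; exists f.
exists alpha, (fun i j => eta (i, j)).
have AE f i : U f -> 1 + vterm alpha f i = (p f i)^-1.
  by move=> Uf; rewrite /vterm -alphaE //; ring.
split.
  (* By p_j V_ij^2 = p_i and V_ij V_ji = 1, the term V_ij / p_i is symmetric in i and j. *)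
  move=> i j ij; apply: (mulIf (lt0r_neq0 (expR_gt0 (f0 0 i + f0 0 j)))).
  have ji : oedge T j i by rewrite oedgeC.
  have /= Ei := etaE (i, j) ij _ Uf0; have /= Ej := etaE (j, i) ji _ Uf0.
  rewrite (addrC (f0 0 j)) in Ej; rewrite -Ei -Ej K_sym; congr (_ - _).
  have pi0 := p0 _ i Uf0; have pj0 := p0 _ j Uf0; have Vn0 := V_neq0 Uf0 ij.
  have -> : V f0 j i = (V f0 i j)^-1.
    by apply: (mulfI Vn0); rewrite V_inv // divff.
  by rewrite -(pV Uf0 ij); field; rewrite pj0 Vn0.
move=> f i j Uf ij; rewrite !AE //; split; try exact/divff/p0.
by rewrite /eterm -(etaE (i, j) ij _ Uf) /= addrC subrK.
Qed.

(** With p = 0 the logarithmic derivatives of V_ij are -1 in f_i and 1 in f_j, so V_ij is a constant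
    v_ij times exp(f_j - f_i). *)
Lemma core_degenerate : (exists f, U f) -> (forall f i, U f -> p f i = 0) ->
  exists (C eta : 'I_n -> 'I_n -> R),
    [/\ triangle_constants T C, forall i j, oedge T i j -> eta i j = eta j i &
    forall f i j, U f -> oedge T i j ->
      `|V f i j| = expR (f 0 j - f 0 i - C i j) /\
      K f i j = (V f i j + V f j i) / 2 + eterm eta f i j].
Proof.
move=> [f0 Uf0] p0.
have vP i j : exists v, oedge T i j -> forall f, U f -> V f i j = v * expR (f 0 j - f 0 i).
  have [ij|_] := boolP (oedge T i j); last by exists 0.
  suff [e eE] : exists v, forall f, U f -> V f i j = v * expR (f 0 j - f 0 i) by exists e.
  apply: (exp_solution (du := fun k f => (j == k)%:R - (i == k)%:R) Uo Uc) => f k Uf.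
    exact: is_derive_ptB (is_derive_coord f j k) (is_derive_coord f i k).
  by apply: is_derive_eq (DV k Uf ij) _; rewrite !p0 //; ring.
have [v vE] := boolp.choice (fun ij : 'I_n * 'I_n => vP ij.1 ij.2).
have etaP i j : exists e, oedge T i j -> forall f, U f ->
    K f i j - (V f i j + V f j i) / 2 = e * expR (f 0 i + f 0 j).
  have [ij|_] := boolP (oedge T i j); last by exists 0.
  suff [e eE] : exists e, forall f, U f ->
    K f i j - (V f i j + V f j i) / 2 = e * expR (f 0 i + f 0 j) by exists e.
  have ji : oedge T j i by rewrite oedgeC.
  apply: (exp_solution (du := fun k f => (i == k)%:R + (j == k)%:R) Uo Uc) => f k Uf.
    exact: is_derive_ptD (is_derive_coord f i k) (is_derive_coord f j k).
  apply: is_derive_eq (is_derive_ptB (DK k Uf ij) (is_derive_ptM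
    (is_derive_ptD (DV k Uf ij) (DV k Uf ji)) (is_derive_pt_cst f 'e_k 2^-1))) _.
  by rewrite !p0 //; field.
have [eta etaE] := boolp.choice (fun ij : 'I_n * 'I_n => etaP ij.1 ij.2).
have v0E i j : oedge T i j -> v (i, j) = V f0 i j * expR (f0 0 i - f0 0 j).
  by move=> ij; rewrite (vE (i, j) ij f0 Uf0) /= -mulrA -expRD (_ : _ + _ = 0) ?expR0 ?mulr1//; ring.
have vn0 i j : oedge T i j -> v (i, j) != 0.
  by move=> ij; rewrite v0E // mulf_neq0 ?V_neq0 // lt0r_neq0 // expR_gt0.
(* The absolute value is there because V_ij may be negative for c = cos. The relations for C come
   from [V_inv] and [V_face] at f0, where the exponentials cancel around a cycle. *)
pose C i j := - ln `|v (i, j)|.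
have C2 i j : oedge T i j -> C i j + C j i = 0.
  move=> ij; have ji : oedge T j i by rewrite oedgeC.
  rewrite /C -opprD -lnM ?posrE ?normr_gt0 ?vn0 // -normrM !v0E //.
  rewrite mulrACA -expRD (_ : f0 0 i - f0 0 j + (f0 0 j - f0 0 i) = 0); last ring.
  by rewrite expR0 mulr1 V_inv // normr1 ln1 oppr0.
exists C, (fun i j => eta (i, j)); split.
- move=> i j k ijk; split; last first.
    move=> r s ri si rs; apply: C2.
    apply: (face_edges ijk); last by rewrite cards2 rs.
    by rewrite finset.subUset !finset.sub1set ri si.
  have [ij _] := face_oedge ijk; have [jk _] := face_oedge (face_rot ijk).
  have [ki _] := face_oedge (face_rot (face_rot ijk)).
  rewrite /C -!opprD -!lnM ?posrE ?mulr_gt0 ?normr_gt0 ?vn0 // -!normrM !v0E //.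
  rewrite (mulrACA (V f0 i j)) (mulrACA (V f0 i j * V f0 j k)) -!expRD.
  rewrite (_ : f0 0 i - f0 0 j + (f0 0 j - f0 0 k) + (f0 0 k - f0 0 i) = 0); last ring.
  by rewrite expR0 mulr1 V_face // normr1 ln1 oppr0.
- move=> i j ij; apply: (mulIf (lt0r_neq0 (expR_gt0 (f0 0 i + f0 0 j)))).
  have ji : oedge T j i by rewrite oedgeC.
  have /= Ei := etaE (i, j) ij _ Uf0; have /= Ej := etaE (j, i) ji _ Uf0.
  rewrite (addrC (f0 0 j)) in Ej; rewrite -Ei -Ej K_sym; congr (_ - _ / _).
  exact: addrC.
- move=> f i j Uf ij; split.
    rewrite (vE (i, j) ij f Uf) normrM (ger0_norm (expR_ge0 _)) mulrC.
    by rewrite /C opprK [RHS]expRD lnK // posrE normr_gt0 vn0.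
  by rewrite /eterm -(etaE (i, j) ij _ Uf) /= addrC subrK.
Qed.

End Core.

(** * First and second partial derivatives of smooth functions *)

Section Smooth.
Context {R : realType} {n : nat} (U : set 'rV[R]_n) (g : 'rV[R]_n -> R).
Hypothesis g_smooth : smooth_on U g.

Lemma smooth_is_derive f k : U f -> is_derive f 'e_k g (partial k g f).
Proof. by move=> Uf; apply/derivableP; have [_] := g_smooth [::] Uf; apply. Qed.

Lemma smooth_is_derive2 f k m : U f ->
  is_derive f 'e_m (partial k g) (partial m (partial k g) f).
Proof. by move=> Uf; apply/derivableP; have [_] := g_smooth [:: k] Uf; apply. Qed.

Lemma smooth_schwarz f k m : open U -> U f ->
  partial m (partial k g) f = partial k (partial m g) f.
Proof.
move=> Uo Uf; apply: (schwarz (U := U) (g := g) (i := k) (j := m)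
  (gi := partial k g) (gj := partial m g)) => //.
- by move=> h Uh; exact: smooth_is_derive.
- by move=> h Uh; exact: smooth_is_derive.
- by move=> h Uh; exact: smooth_is_derive2.
- by move=> h Uh; exact: smooth_is_derive2.
- by have [] := g_smooth [:: m; k] Uf.
- by have [] := g_smooth [:: k; m] Uf.
Qed.

End Smooth.

(** * The compatibility equations in the three geometries *)

(* The three geometries are sigma = 0, 1, -1 with (c, s) = (1, id),
   (cosh, sinh), (cos, sin). *)
Section Trigonometry.
Context {R : realType} (sigma : R) (c s : R -> R).
Hypothesis Dc : forall x : R, is_derive x 1 c (sigma * s x).
Hypothesis Ds : forall x : R, is_derive x 1 s (c x).
Hypothesis c2s2 : forall x, c x ^+ 2 - sigma * s x ^+ 2 = 1.

Definition tangent x := s x / c x.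

Lemma is_derive_tangent x : c x != 0 -> is_derive x 1 tangent (c x ^- 2).
Proof.
move=> cx0.
apply: is_derive_eq (is_derive_ptM (Ds x) (is_derive_ptV cx0 (Dc x))) _.
by rewrite -[RHS]mul1r -(c2s2 x); field.
Qed.

Context {n : nat} (T : triangulated_closed_surface n).
Context (U : set 'rV[R]_n) (Uo : open U) (d : 'rV[R]_n -> 'I_n -> 'I_n -> R).
Hypothesis d_smooth : forall i j, oedge T i j -> smooth_on U (fun f => d f i j).
Hypothesis c_neq0 : forall f i j, U f -> oedge T i j -> c (d f i j) != 0.
Hypothesis D_length : forall f i j, U f -> oedge T i j ->
  partial i (fun g => edge_length (d g) i j) f = tangent (d f i j).
Hypothesis d_local : forall i j k f, oedge T i j -> U f -> k != i -> k != j ->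
  partial k (fun g => d g i j) f = 0.

Let dd k i j := partial k (fun g => d g i j).

Let Dd f i j k : U f -> oedge T i j -> is_derive f 'e_k (fun g => d g i j) (dd k i j f).
Proof. by move=> Uf ij; exact: smooth_is_derive (d_smooth ij) _ _ Uf. Qed.

Let Ddd f i j k m : U f -> oedge T i j ->
  is_derive f 'e_m (dd k i j) (partial m (dd k i j) f).
Proof. by move=> Uf ij; exact: smooth_is_derive2 (d_smooth ij) _ _ _ Uf. Qed.

Let Dtan f i j k : U f -> oedge T i j ->
  is_derive f 'e_k (fun g => tangent (d g i j)) (c (d f i j) ^- 2 * dd k i j f).
Proof.
by move=> Uf ij; apply: is_derive_comp (is_derive_tangent (c_neq0 Uf ij)) (Dd k Uf ij).
Qed.

Lemma dd_sum f i j : U f -> oedge T i j -> dd i i j f + dd i j i f = tangent (d f i j).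
Proof.
move=> Uf ij; rewrite -(D_length Uf ij); apply/esym.
have ji : oedge T j i by rewrite oedgeC.
by have [_] := is_derive_ptD (Dd i Uf ij) (Dd i Uf ji).
Qed.

(** The identities dl/df_i = tangent(d_ij) and dl/df_j = tangent(d_ji) are differentiated in f_j and
    f_i respectively, and Schwarz's theorem equates the results. *)
Lemma mixed_partials f i j : U f -> oedge T i j ->
  c (d f i j) ^- 2 * dd j i j f = c (d f j i) ^- 2 * dd i j i f.
Proof.
move=> Uf ij; have ji : oedge T j i by rewrite oedgeC.
have E k l m : oedge T k l ->
    c (d f k l) ^- 2 * dd m k l f = partial m (dd k k l) f + partial m (dd k l k) f.
  move=> kl; have lk : oedge T l k by rewrite oedgeC.
  apply: is_derive_uniq (is_derive_ptD (Ddd k m Uf kl) (Ddd k m Uf lk)).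
  apply: (is_derive_eq_on Uo Uf _ (Dtan m Uf kl)) => g Ug.
  by rewrite dd_sum.
apply: (etrans (E i j j ij)); apply: (etrans _ (esym (E j i i ji))).
rewrite [LHS]addrC; apply: (congr2 +%R).
  exact: (smooth_schwarz (d_smooth ji) i j Uo Uf).
exact: (smooth_schwarz (d_smooth ij) i j Uo Uf).
Qed.

(* sigma * phi f i j is the derivative of log|cratio f i j| with respect to f_i. *)
Definition phi f i j := tangent (d f j i) * dd i j i f - tangent (d f i j) * dd i i j f.

(** With x = d_ij, y = d_ji and e = dx/df_j, [dd_sum] and [mixed_partials] eliminate the other
    derivatives; both sides become 1 + sigma e (s(x) c(y)^2 / c(x) + s(y) c(y)). *)
Lemma phi_compat f i j : U f -> oedge T i j ->
  (1 + sigma * phi f j i) * c (d f j i) ^+ 2 =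
  (1 + sigma * phi f i j) * c (d f i j) ^+ 2.
Proof.
move=> Uf ij; have ji : oedge T j i by rewrite oedgeC.
have := mixed_partials Uf ij; have := dd_sum Uf ij; have := dd_sum Uf ji.
have := c_neq0 Uf ij; have := c_neq0 Uf ji; rewrite /phi /tangent.
have := c2s2 (d f i j); have := c2s2 (d f j i).
set cx := c (d f i j); set cy := c (d f j i).
set sx := s (d f i j); set sy := s (d f j i).
set a := dd i i j f; set b := dd i j i f; set e := dd j i j f; set g := dd j j i f.
move=> Ey Ex cy0 cx0 Eg Ea Em.
have {Eg} -> : g = sy / cy - e by rewrite -Eg; ring.
have {Ea} -> : a = sx / cx - b by rewrite -Ea; ring.
have -> : b = (cx ^- 2 * e) * cy ^+ 2 by rewrite Em; field.
transitivity (cy ^+ 2 - sigma * sy ^+ 2 +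
   sigma * e * (sx * cy ^+ 2 / cx + sy * cy)); first by field; rewrite cx0 cy0.
by rewrite Ey -{1}Ex; field; rewrite cx0 cy0.
Qed.

(** Neither d_ij and d_ji nor their derivatives in f_i vary with f_m: by Schwarz's theorem the mixed
    derivative is the f_i-derivative of 0. *)
Lemma phi_local f i j m : U f -> oedge T i j -> m != i -> m != j ->
  is_derive f 'e_m (fun g => phi g i j) 0.
Proof.
move=> Uf ij mi mj; have ji : oedge T j i by rewrite oedgeC.
have Z k l : oedge T k l -> m != k -> m != l -> partial m (dd i k l) f = 0.
  move=> kl mk ml; rewrite /dd (smooth_schwarz (d_smooth kl) i m Uo Uf).
  apply: is_derive_uniq (Ddd m i Uf kl) _.
  apply: (is_derive_eq_on Uo Uf _ (is_derive_pt_cst f 'e_i 0)) => g Ug.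
  by rewrite /dd d_local.
apply: is_derive_eq (is_derive_ptB
  (is_derive_ptM (Dtan m Uf ji) (Ddd i m Uf ji))
  (is_derive_ptM (Dtan m Uf ij) (Ddd i m Uf ij))) _.
by rewrite !Z // /dd (d_local ij Uf mi mj) (d_local ji Uf mj mi); ring.
Qed.

Section Link.
(** Kept as an assumption here because its source differs: the product relation for [cratio] when
    sigma != 0, the relation between squares when sigma = 0. *)
Hypothesis phi_face : forall f i j k, U f -> face T i j k -> phi f i j = phi f i k.

Lemma phi_link f i j k : U f -> oedge T i j -> oedge T i k -> phi f i j = phi f i k.
Proof. by move=> Uf; apply: link_const => a b e; exact: phi_face. Qed.

(** Even dependence on f_j is excluded: [phi]_ij equals [phi]_ik on U for a neighbor k != m, and
    [phi_local] applies to the edge ik. *)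
Lemma phi_vertex f i j m : U f -> oedge T i j -> m != i ->
  is_derive f 'e_m (fun g => phi g i j) 0.
Proof.
move=> Uf ij mi; have [k ik km] := vertex_neighbor_neq T i m.
apply: is_derive_eq_on Uo Uf _ (phi_local Uf ik mi _); last by rewrite eq_sym.
by move=> g Ug; exact: phi_link.
Qed.

End Link.

Definition cratio f i j := c (d f j i) / c (d f i j).

Lemma cratioC f i j : cratio f j i = (cratio f i j)^-1.
Proof. by rewrite /cratio invf_div. Qed.

Let ratio_inv f i j : U f -> oedge T i j -> cratio f i j * cratio f j i = 1.
Proof.
move=> Uf ij; have ji : oedge T j i by rewrite oedgeC.
by rewrite /cratio; field; rewrite !c_neq0.
Qed.

Let D_cratio f i j k : U f -> oedge T i j ->
  is_derive f 'e_k (fun g => cratio g i j) (cratio f i j *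
    (sigma * (tangent (d f j i) * dd k j i f - tangent (d f i j) * dd k i j f))).
Proof.
move=> Uf ij; have ji : oedge T j i by rewrite oedgeC.
have cx0 := c_neq0 Uf ij; have cy0 := c_neq0 Uf ji.
apply: is_derive_eq (is_derive_ptM (is_derive_comp (Dc (d f j i)) (Dd k Uf ji))
  (is_derive_ptV cx0 (is_derive_comp (Dc (d f i j)) (Dd k Uf ij)))) _.
by rewrite /cratio /tangent; field; rewrite cx0 cy0.
Qed.

(** The ratio never vanishes, so its sign has zero partial derivatives. *)
Lemma sg_cratio_const i j : connected U -> oedge T i j ->
  exists e, forall f, U f -> Num.sg (cratio f i j) = e.
Proof.
move=> Uc ij; apply: zero_partials_cst => // f k Uf.
have V0 : cratio f i j != 0.
  apply/eqP => V0; have := ratio_inv Uf ij.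
  by rewrite V0 mul0r => /eqP; rewrite eq_sym oner_eq0.
have := is_derive_comp (g := fun g => cratio g i j) (is_derive_sgr V0) (D_cratio k Uf ij).
by rewrite mul0r.
Qed.

Let D_cratio_delta f i j k : U f -> oedge T i j ->
  is_derive f 'e_k (fun g => cratio g i j) (cratio f i j *
    (sigma * ((i == k)%:R * phi f i j - (j == k)%:R * phi f j i))).
Proof.
move=> Uf ij; have ji : oedge T j i by rewrite oedgeC.
apply: is_derive_eq (D_cratio k Uf ij) _; congr (_ * (_ * _)).
have nij := oedge_neq ij; rewrite /phi.
have [<-|ik] := eqVneq i k; first by rewrite (eq_sym j) (negbTE nij) mul1r mul0r subr0.
have [<-|jk] := eqVneq j k; first by rewrite /=; ring.
rewrite /dd (d_local (k := k) ij Uf) ?(d_local (k := k) ji Uf) // 1?eq_sym //.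
by rewrite /=; ring.
Qed.

Hypothesis cratio_face : forall f i j k, U f -> face T i j k ->
  cratio f i j * cratio f j k * cratio f k i = 1.
Hypothesis sigma_neq0 : sigma != 0.

(** In the logarithmic f_i-derivative of the face relation, V_ij contributes sigma [phi]_ij, V_ki
    contributes -sigma [phi]_ik, and V_jk nothing. *)
Lemma phi_face f i j k : U f -> face T i j k -> phi f i j = phi f i k.
Proof.
move=> Uf ijk.
have [ij _] := face_oedge ijk; have [jk _] := face_oedge (face_rot ijk).
have [ki _] := face_oedge (face_rot (face_rot ijk)).
have [nij njk nki] := face_third_neq ijk.
have /is_derive_uniq/(_ (is_derive_eq_on Uo Uf (fun g Ug => esym (cratio_face Ug ijk))
   (is_derive_pt_cst f 'e_i 1))) :=
  is_derive_ptM (is_derive_ptM (D_cratio_delta i Uf ij) (D_cratio_delta i Uf jk))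
    (D_cratio_delta i Uf ki).
rewrite eqxx (eq_sym j) (negbTE nij) (negbTE nki) /= => E.
apply/eqP; rewrite -subr_eq0; apply/eqP; apply: (mulfI sigma_neq0).
rewrite mulr0 -[LHS]mul1r -(cratio_face Uf ijk) -[RHS]E; ring.
Qed.

Hypothesis cD : forall x y, c (x + y) = c x * c y + sigma * (s x * s y).
Hypothesis sD : forall x y, s (x + y) = s x * c y + c x * s y.

(** With x = d_ij and y = d_ji, the addition formulas reduce the left side to c(y) (c(x)^2 - sigma
    s(x)^2) / c(x). Solved for the tangent, this gives the formulas for d_ij. *)
Lemma cos_length f i j : U f -> oedge T i j ->
  c (edge_length (d f) i j) - sigma * (s (edge_length (d f) i j) * tangent (d f i j)) =
  cratio f i j.
Proof.
move=> Uf ij; have cx0 := c_neq0 Uf ij.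
rewrite /edge_length /cratio /tangent cD sD -[RHS]mulr1 -[in RHS](c2s2 (d f i j)).
by field.
Qed.

Lemma D_cos_length f i j k : U f -> oedge T i j ->
  is_derive f 'e_k (fun g => c (edge_length (d g) i j))
    ((i == k)%:R * (c (edge_length (d f) i j) - cratio f i j) +
     (j == k)%:R * (c (edge_length (d f) i j) - cratio f j i)).
Proof.
move=> Uf ij; have ji : oedge T j i by rewrite oedgeC.
have El : edge_length (d f) i j = edge_length (d f) j i by rewrite /edge_length addrC.
have Dl : is_derive f 'e_k (fun g => edge_length (d g) i j) (dd k i j f + dd k j i f).
  exact: is_derive_ptD (Dd k Uf ij) (Dd k Uf ji).
apply: is_derive_eq (is_derive_comp (g := fun g => edge_length (d g) i j)
  (Dc (edge_length (d f) i j)) Dl) _.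
have nij := oedge_neq ij.
have [<-|ik] := eqVneq i k.
  by rewrite (eq_sym j) (negbTE nij) dd_sum // -(cos_length Uf ij) /=; ring.
have [<-|jk] := eqVneq j k.
  by rewrite (addrC (dd _ _ _ _)) dd_sum // -(cos_length Uf ji) -El /=; ring.
rewrite /dd (d_local (k := k) ij Uf) ?(d_local (k := k) ji Uf) // 1?eq_sym //.
by rewrite /=; ring.
Qed.

Hypothesis Uc : connected U.

Lemma trigonometric_dichotomy :
  (exists (alpha : 'I_n -> R) (eta : 'I_n -> 'I_n -> R),
    (forall i j, oedge T i j -> eta i j = eta j i) /\
    forall f i j, U f -> oedge T i j ->
      [/\ 1 + vterm alpha f i != 0,
         (1 + vterm alpha f i) * cratio f i j ^+ 2 = 1 + vterm alpha f j &
         c (edge_length (d f) i j) =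
           (1 + vterm alpha f i) * cratio f i j + eterm eta f i j]) \/
  (exists (C eta : 'I_n -> 'I_n -> R),
    [/\ triangle_constants T C, forall i j, oedge T i j -> eta i j = eta j i &
    forall f i j, U f -> oedge T i j ->
      `|cratio f i j| = expR (f 0 j - f 0 i - C i j) /\
      c (edge_length (d f) i j) = (cratio f i j + cratio f j i) / 2 + eterm eta f i j]).
Proof.
have [nb nbP] := vertex_neighbor T.
(* The neighbor [nb i] is arbitrary, since [phi] takes the same value on all edges from i. *)
pose p f i := 1 + sigma * phi f i (nb i).
have pE f i j : U f -> oedge T i j -> p f i = 1 + sigma * phi f i j.
  by move=> Uf ij; rewrite /p (phi_link phi_face Uf (nbP i) ij).
have DV f i j k : U f -> oedge T i j -> is_derive f 'e_k (fun g => cratio g i j)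
    (cratio f i j * ((i == k)%:R * (p f i - 1) - (j == k)%:R * (p f j - 1))).
  move=> Uf ij; have ji : oedge T j i by rewrite oedgeC.
  apply: is_derive_eq (D_cratio_delta k Uf ij) _.
  by rewrite (pE _ _ _ Uf ij) (pE _ _ _ Uf ji); ring.
have Dp f i k : U f -> i != k -> is_derive f 'e_k (p ^~ i) 0.
  move=> Uf ik; rewrite eq_sym in ik.
  have Dphi := phi_vertex phi_face Uf (nbP i) ik.
  apply: is_derive_eq (is_derive_ptD (is_derive_pt_cst f 'e_k 1) (is_derive_ptZ sigma Dphi)) _.
  by rewrite mulr0 addr0.
have pV f i j : U f -> oedge T i j -> p f j * cratio f i j ^+ 2 = p f i.
  move=> Uf ij; have ji : oedge T j i by rewrite oedgeC.
  rewrite (pE _ _ _ Uf ij) (pE _ _ _ Uf ji) /cratio expr_div_n mulrA phi_compat //.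
  by rewrite mulfK // expf_neq0 // c_neq0.
have Ksym f i j : c (edge_length (d f) i j) = c (edge_length (d f) j i).
  by rewrite /edge_length addrC.
have [[f0 [Uf0 [i p0]]]|pn0] := pselect (exists f, U f /\ exists i, p f i = 0).
- right; have [||C [eta [HC Heta H]]] := core_degenerate Uo Uc ratio_inv cratio_face
    Ksym DV D_cos_length.
  + by exists f0.
  + exact: (p_zero_everywhere Uo Uc Dp pV Uf0 p0).
  + by exists C, eta.
- left; have [|alpha [eta [Heta H]]] := core_nondegenerate Uo Uc ratio_inv Ksym DV Dp pV D_cos_length.
    by move=> f i Uf; apply/eqP => p0; apply: pn0; exists f; split=> //; exists i.
  exists alpha, eta; split=> // f i j Uf ij; have [Ei Ej EK] := H f i j Uf ij.
  have := pV f i j Uf ij; move: Ei Ej EK.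
  set A := 1 + _; set B := 1 + vterm _ _ _; set W := cratio _ _ _ => Ei Ej -> pVij.
  (* Both 1 + A_i and 1 + A_j are reciprocals of values of p, which turns p_j V_ij^2 = p_i into the
     stated relation. *)
  have A0 : A != 0 by apply/eqP => A0; move/eqP: Ei; rewrite A0 mulr0 eq_sym oner_eq0.
  split=> //.
  by rewrite -[LHS]mulr1 -Ej -[RHS]mul1r -Ei -pVij; ring.
Qed.

End Trigonometry.

(** * The explicit forms *)

Section Edges.
Context {R : realType} {n : nat} (T : triangulated_closed_surface n).

Lemma partial_edge_lengths_gt0 G (d : 'I_n -> 'I_n -> R) i j :
  partial_edge_lengths G T d -> oedge T i j -> 0 < edge_length d i j.
Proof. by move=> [[dl _] _] /dl[]. Qed.

End Edges.

(** * Sides of spherical triangles lie strictly between 0 and pi *)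

Section SphericalTriangles.
Context {R : realType}.

Lemma dotDD m (u v : 'rV[R]_m) : dot (u + v) (u + v) = dot u u + 2 * dot u v + dot v v.
Proof.
rewrite /dot mulr_sumr -!big_split /=; apply: eq_bigr => a _.
by rewrite !mxE; ring.
Qed.

Lemma dotBB m (u v : 'rV[R]_m) : dot (u - v) (u - v) = dot u u - 2 * dot u v + dot v v.
Proof.
rewrite /dot mulr_sumr -sumrB -big_split /=; apply: eq_bigr => a _.
by rewrite !mxE; ring.
Qed.

Lemma dot_ge0 m (u : 'rV[R]_m) : 0 <= dot u u.
Proof. by apply: sumr_ge0 => a _; rewrite -expr2 sqr_ge0. Qed.

Lemma dot_eq0 m (u : 'rV[R]_m) : dot u u = 0 -> u = 0.
Proof.
move=> /eqP; rewrite psumr_eq0; last by move=> a _; rewrite -expr2 sqr_ge0.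
move=> /allP u0; apply/rowP => a; have := u0 a; rewrite mem_index_enum mxE.
by move=> /(_ isT); rewrite mulf_eq0 orbb => /eqP.
Qed.

(** The rank condition excludes antipodal p and q, so the side acos(p.q) is less than pi. *)
Lemma spherical_side_sin_neq0 (a b c : R) :
  0 < a -> embedded_triangle Spherical a b c -> sin a != 0.
Proof.
move=> a0 [p [q [r [[p1 q1 _] [rk ap _ _]]]]].
have le1 : dot p q <= 1.
  by have := dot_ge0 (p - q); rewrite dotBB (p1 : dot p p = 1) (q1 : dot q q = 1); lra.
have ge1 : -1 <= dot p q.
  by have := dot_ge0 (p + q); rewrite dotDD (p1 : dot p p = 1) (q1 : dot q q = 1); lra.
have gtN1 : -1 < dot p q.
  rewrite lt_neqAle ge1 andbT; apply/eqP => Epq.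
  have pq : p + q = 0.
    apply: dot_eq0; rewrite dotDD (p1 : dot p p = 1) (q1 : dot q q = 1) -Epq; lra.
  (* If q = -p, the nonzero row (1, 1, 0) annihilates the matrix with rows p, q, r, against its full
     rank. *)
  have : row_mx 1%:M (row_mx 1%:M 0) *m col_mx p (col_mx q r) = 0.
    by rewrite !mul_row_col !mul1mx mul0mx addr0.
  move=> /eqP; rewrite mulmx_free_eq0; last by rewrite /row_free rk.
  move=> /eqP/matrixP/(_ 0 0); rewrite !mxE; case: splitP => // k _.
  by rewrite (ord1 k) !mxE eqxx => /eqP; rewrite oner_eq0.
have [/andP[_ api] _] := @acos_def R (dot p q) (introT andP (conj ge1 le1)).
have alt : a < pi by rewrite -ap acos_ltpi // gtN1 le1.
by rewrite gt_eqF // sin_gt0_pi // a0.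
Qed.

End SphericalTriangles.

(** * Identities and derivatives of hyperbolic functions *)

Section HyperbolicIdentities.
Context {R : realType}.
Implicit Types x y : R.

Lemma cosh_gt0 x : 0 < cosh x.
Proof. by rewrite divr_gt0 // addr_gt0 // expR_gt0. Qed.

Lemma sinh_gt0 x : 0 < x -> 0 < sinh x.
Proof. by move=> x0; rewrite divr_gt0 // subr_gt0 ltr_expR; lra. Qed.

Lemma is_derive_expRN x : is_derive x 1 (fun x : R => expR (- x)) (- expR (- x)).
Proof.
have := is_derive_comp (is_derive_expR (- x)) (is_deriveNid x (1 : R)).
by rewrite mulrN1.
Qed.

Lemma is_derive_cosh x : is_derive x 1 cosh (sinh x).
Proof.
apply: is_derive_eq (is_derive_ptM (is_derive_ptD (is_derive_expR x) (is_derive_expRN x))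
  (is_derive_pt_cst x 1 2^-1)) _.
by rewrite mulr0 addr0.
Qed.

Lemma is_derive_sinh x : is_derive x 1 sinh (cosh x).
Proof.
apply: is_derive_eq (is_derive_ptM (is_derive_ptB (is_derive_expR x) (is_derive_expRN x))
  (is_derive_pt_cst x 1 2^-1)) _.
by rewrite mulr0 addr0 opprK.
Qed.

Lemma cosh2Bsinh2 x : cosh x ^+ 2 - sinh x ^+ 2 = 1.
Proof.
have E : expR x * expR (- x) = 1 by rewrite -expRD subrr expR0.
by rewrite -[RHS]E /cosh /sinh; field.
Qed.

Lemma coshD x y : cosh (x + y) = cosh x * cosh y + sinh x * sinh y.
Proof. by rewrite /cosh /sinh opprD !expRD; field. Qed.

Lemma sinhD x y : sinh (x + y) = sinh x * cosh y + cosh x * sinh y.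
Proof. by rewrite /cosh /sinh opprD !expRD; field. Qed.

End HyperbolicIdentities.

Lemma cyclic_ratio {R : fieldType} (x y z x' y' z' : R) :
  x != 0 -> y != 0 -> z != 0 -> x * y * z = x' * y' * z' ->
  x' / x * (y' / y) * (z' / z) = 1.
Proof. by move=> x0 y0 z0 E; rewrite !mulf_div -E divff // !mulf_neq0. Qed.

(** * From ratios to square roots *)

Section SquareRootForm.
Context {R : realType}.
Implicit Types a b v : R.

Lemma ratio_sqrt a b v : a != 0 -> 0 < v -> a * v ^+ 2 = b -> v = Num.sqrt (b / a).
Proof. by move=> a0 v0 <-; rewrite mulrAC divff // mul1r sqrtr_sqr gtr0_norm. Qed.

(** Since a b = (a v)^2, the root is |a v|, and its sign cases are the two sign conditions of the
    theorem. In use, a and b are 1 + A_i and 1 + A_j, and v is |V_ij|. *)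
Lemma prod_sqrt_cases a b v : a != 0 -> 0 < v -> a * v ^+ 2 = b ->
  [/\ 0 < a, 0 < b & Num.sqrt (a * b) = a * v] \/
  [/\ a < 0, b < 0 & Num.sqrt (a * b) = - (a * v)].
Proof.
move=> a0 v0 <-; have -> : a * (a * v ^+ 2) = (a * v) ^+ 2 by ring.
rewrite sqrtr_sqr.
have v20 : 0 < v ^+ 2 by rewrite exprn_gt0.
have [alt|agt|//] := ltgtP a 0; last by move/eqP in a0.
  by right; split; rewrite ?nmulr_rlt0 // ltr0_norm // nmulr_rlt0.
by left; split; rewrite ?mulr_gt0 // gtr0_norm // mulr_gt0.
Qed.

End SquareRootForm.

(** * Hyperbolic background geometry *)

Section HyperbolicCase.
Context {R : realType} {n : nat} (T : triangulated_closed_surface n).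
Context (U : set 'rV[R]_n) (d : 'rV[R]_n -> 'I_n -> 'I_n -> R).

Lemma hyperbolic_forms : connected U -> discrete_conformal_structure Hyperbolic T U d ->
  exists (alpha : 'I_n -> R) (eta : 'I_n -> 'I_n -> R),
    (forall i j, oedge T i j -> eta i j = eta j i) /\
    ((forall f i j, U f -> oedge T i j -> formB1 alpha eta d f i j) \/
     (exists C : 'I_n -> 'I_n -> R, triangle_constants T C /\
        forall f i j, U f -> oedge T i j -> formB2 eta C d f i j)).
Proof.
move=> Uc [Uo sm dpl Dl loc].
have c2s2 (x : R) : cosh x ^+ 2 - 1 * sinh x ^+ 2 = 1 by rewrite mul1r cosh2Bsinh2.
have Dc (x : R) : is_derive x 1 (@cosh R) (1 * sinh x) by rewrite mul1r; exact: is_derive_cosh.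
have cD (x y : R) : cosh (x + y) = cosh x * cosh y + 1 * (sinh x * sinh y).
  by rewrite mul1r coshD.
have c0 f i j : U f -> oedge T i j -> cosh (d f i j) != 0.
  by move=> _ _; rewrite gt_eqF // cosh_gt0.
have Dl' f i j : U f -> oedge T i j ->
    partial i (fun g => edge_length (d g) i j) f = tangent cosh sinh (d f i j).
  by move=> Uf ij; exact: Dl ij Uf.
have Vf f i j k : U f -> face T i j k ->
    cratio cosh d f i j * cratio cosh d f j k * cratio cosh d f k i = 1.
  by move=> /dpl[_ H] /H E; apply: cyclic_ratio => //; rewrite gt_eqF // cosh_gt0.
have V0 f i j : 0 < cratio cosh d f i j by rewrite divr_gt0 // cosh_gt0.
have tanhE f i j : U f -> oedge T i j -> tanh (d f i j) =
    (cosh (edge_length (d f) i j) - cratio cosh d f i j) / sinh (edge_length (d f) i j).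
  move=> Uf ij; have l0 := sinh_gt0 (partial_edge_lengths_gt0 (dpl f Uf) ij).
  rewrite -(cos_length c2s2 c0 cD sinhD Uf ij) mul1r opprB addrCA subrr addr0.
  by rewrite mulrAC divff ?mul1r // gt_eqF.
have l0 f i j : U f -> oedge T i j -> sinh (edge_length (d f) i j) != 0.
  by move=> Uf ij; rewrite gt_eqF // (sinh_gt0 (partial_edge_lengths_gt0 (dpl f Uf) ij)).
have [[alpha [eta [Heta H]]]|[C [eta [HC Heta H]]]] := trigonometric_dichotomy Dc
  (@is_derive_sinh R) c2s2 Uo sm c0 Dl' loc Vf (oner_neq0 _) cD sinhD Uc.
- exists alpha, eta; split => //; left => f i j Uf ij.
  have [a0 pV K] := H f i j Uf ij; rewrite /formB1.
  rewrite -(ratio_sqrt a0 (V0 f i j) pV) tanhE // K; split.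
    by field; exact: l0.
  have [[ai aj ->]|[ai aj ->]] := prod_sqrt_cases a0 (V0 f i j) pV; [left|right] => //.
  by rewrite opprK.
- exists (fun=> 0), eta; split => //; right; exists C; split=> // f i j Uf ij.
  have [+ K] := H f i j Uf ij; rewrite (gtr0_norm (V0 f i j)) => VE.
  (* Here V_ij = exp(u) with u = f_j - f_i - C_ij, and V_ji is its inverse. *)
  have Cu : cosh (f 0 j - f 0 i - C i j) = (cratio cosh d f i j + cratio cosh d f j i) / 2.
    by rewrite [LHS]/cosh expRN -VE (cratioC _ _ f i j).
  have Su : sinh (f 0 j - f 0 i - C i j) = (cratio cosh d f i j - cratio cosh d f j i) / 2.
    by rewrite [LHS]/sinh expRN -VE (cratioC _ _ f i j).
  rewrite /formB2 tanhE // K Cu Su; split=> //.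
  by field; exact: l0.
Qed.

End HyperbolicCase.

(** * Spherical background geometry *)

Section SphericalCase.
Context {R : realType} {n : nat} (T : triangulated_closed_surface n).
Context (U : set 'rV[R]_n) (d : 'rV[R]_n -> 'I_n -> 'I_n -> R).

Lemma spherical_forms : connected U -> discrete_conformal_structure Spherical T U d ->
  exists (alpha : 'I_n -> R) (eta : 'I_n -> 'I_n -> R),
    (forall i j, oedge T i j -> eta i j = eta j i) /\
    ((forall f i j, U f -> oedge T i j ->
        (same_sign_edge d f i j -> formC1 alpha eta d f i j) /\
        (opposite_sign_edge d f i j -> formC3 alpha eta d f i j)) \/
     (exists C : 'I_n -> 'I_n -> R, triangle_constants T C /\
      forall f i j, U f -> oedge T i j ->
        (same_sign_edge d f i j -> formC2 eta C d f i j) /\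
        (opposite_sign_edge d f i j -> formC4 eta C d f i j))).
Proof.
move=> Uc [Uo sm dpl Dl loc].
have [[f0 Uf0]|U0] := pselect (exists f, U f); last first.
  exists (fun=> 0), (fun _ _ => 0); split=> //; left => f i j Uf.
  by case: U0; exists f.
have Dc (x : R) : is_derive x 1 (@cos R) (-1 * sin x) by rewrite mulN1r; exact: is_derive_cos.
have c2s2 (x : R) : cos x ^+ 2 - -1 * sin x ^+ 2 = 1 by rewrite mulN1r opprK cos2Dsin2.
have cD' (x y : R) : cos (x + y) = cos x * cos y + -1 * (sin x * sin y).
  by rewrite cosD mulN1r.
have sD' (x y : R) : sin (x + y) = sin x * cos y + cos x * sin y by exact: sinD.
have c0 f i j : U f -> oedge T i j -> cos (d f i j) != 0.
  by move=> Uf ij; have [] := Dl i j f ij Uf.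
have Dl' f i j : U f -> oedge T i j ->
    partial i (fun g => edge_length (d g) i j) f = tangent cos sin (d f i j).
  by move=> Uf ij; have [] := Dl i j f ij Uf.
have Vf f i j k : U f -> face T i j k ->
    cratio cos d f i j * cratio cos d f j k * cratio cos d f k i = 1.
  move=> Uf ijk; have [_ H] := dpl f Uf.
  have [ij _] := face_oedge ijk; have [jk _] := face_oedge (face_rot ijk).
  have [ki _] := face_oedge (face_rot (face_rot ijk)).
  by apply: cyclic_ratio; rewrite ?c0 //; exact: H.
have l0 f i j : U f -> oedge T i j -> sin (edge_length (d f) i j) != 0.
  move=> Uf ij; have [k ijk] := oedge_face ij.
  apply: (@spherical_side_sin_neq0 _ _ (edge_length (d f) j k) (edge_length (d f) k i)).
    exact: partial_edge_lengths_gt0 (dpl f Uf) ij.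
  by have [[_ H] _] := dpl f Uf; exact: H.
have tanE f i j : U f -> oedge T i j -> tan (d f i j) =
    (cratio cos d f i j - cos (edge_length (d f) i j)) / sin (edge_length (d f) i j).
  move=> Uf ij; rewrite -(cos_length c2s2 c0 cD' sD' Uf ij) mulN1r opprK addrAC subrr add0r.
  by rewrite mulrAC divff ?mul1r // l0.
have N1 : (-1 : R) != 0 by rewrite oppr_eq0 oner_eq0.
have Vinv f i j : cratio cos d f j i = (cratio cos d f i j)^-1 by exact: cratioC.
(* The sign of V_ij, the same at all points of U; it is absorbed into eta below. *)
pose e i j := Num.sg (cratio cos d f0 i j).
have eE f i j : U f -> oedge T i j -> Num.sg (cratio cos d f i j) = e i j.
  move=> Uf ij; have [x xE] := sg_cratio_const Dc Uo sm c0 Uc ij.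
  by rewrite /e !xE.
have eC i j : e i j = e j i by rewrite /e (Vinv _ i j) sgrV.
have same f i j : U f -> oedge T i j -> same_sign_edge d f i j ->
    0 < cratio cos d f i j /\ e i j = 1.
  (* The quotient in [same_sign_edge] is V_ji, whose inverse V_ij has the same sign. *)
  move=> Uf ij S; have V0 : 0 < cratio cos d f i j.
    by rewrite Vinv invr_gt0.
  by split=> //; rewrite -(eE f) // gtr0_sg.
have opp f i j : U f -> oedge T i j -> opposite_sign_edge d f i j ->
    0 < - cratio cos d f i j /\ e i j = -1.
  move=> Uf ij S; have V0 : cratio cos d f i j < 0.
    by rewrite Vinv invr_lt0.
  by rewrite oppr_gt0; split=> //; rewrite -(eE f) // ltr0_sg.
have [[alpha [eta [Heta H]]]|[C [eta [HC Heta H]]]] := trigonometric_dichotomy Dc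
  (@is_derive_sin R) c2s2 Uo sm c0 Dl' loc Vf N1 cD' sD' Uc.
(* The dichotomy gives cos l = (1 + A_i) V_ij + H. Negating alpha yields 1 - A_i, and the factor -e
   gives H the sign of (c1) when V_ij > 0 and of (c3) when V_ij < 0. *)
- exists (fun i => - alpha i), (fun i j => - e i j * eta i j); split.
    by move=> i j ij; rewrite Heta // eC.
  left => f i j Uf ij; have [a0 pV K] := H f i j Uf ij.
  rewrite /formC1 /formC3 /vterm /eterm !mulNr !opprK -/(vterm alpha f i) -/(vterm alpha f j).
  split=> [/(same _ _ _ Uf ij)[V0 ->]|/(opp _ _ _ Uf ij)[V0 ->]].
    rewrite -(ratio_sqrt a0 V0 pV) tanE // K; split.
      by rewrite /eterm; field; exact: l0.
    have [[ai aj ->]|[ai aj ->]] := prod_sqrt_cases a0 V0 pV; [left|right]; split => //;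
      rewrite /eterm; ring.
  (* For negative V_ij the square root is -V_ij. *)
  rewrite -sqrrN in pV.
  rewrite -(ratio_sqrt a0 V0 pV) tanE // K; split.
    by rewrite /eterm; field; exact: l0.
  have [[ai aj ->]|[ai aj ->]] := prod_sqrt_cases a0 V0 pV; [left|right]; split => //;
    rewrite /eterm; ring.
- exists (fun=> 0), (fun i j => - e i j * eta i j); split.
    by move=> i j ij; rewrite Heta // eC.
  right; exists C; split=> // f i j Uf ij; have [VE K] := H f i j Uf ij.
  rewrite /formC2 /formC4 tanE // K /cosh /sinh expRN -VE (Vinv f i j) /eterm.
  have s0 := l0 f i j Uf ij.
  split=> [/(same _ _ _ Uf ij)[V0 ->]|/(opp _ _ _ Uf ij)[V0 ->]].
    rewrite gtr0_norm //; have Vn0 := lt0r_neq0 V0.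
    by split; field; rewrite ?s0 ?Vn0.
  have Vlt : cratio cos d f i j < 0 by rewrite -oppr_gt0.
  have Vn0 := ltr0_neq0 Vlt.
  by rewrite ltr0_norm //; split; field; rewrite ?s0 ?Vn0.
Qed.

End SphericalCase.

(** * Euclidean background geometry *)

Section EuclideanCase.
Context {R : realType} {n : nat} (T : triangulated_closed_surface n).
Context (U : set 'rV[R]_n) (d : 'rV[R]_n -> 'I_n -> 'I_n -> R).

Lemma euclidean_forms : connected U -> discrete_conformal_structure Euclidean T U d ->
  exists (alpha : 'I_n -> R) (eta : 'I_n -> 'I_n -> R),
    (forall i j, oedge T i j -> eta i j = eta j i) /\
    forall f i j, U f -> oedge T i j -> formA alpha eta d f i j.
Proof.
move=> Uc [Uo sm dpl Dl loc].
pose c := fun _ : R => 1 : R.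
have Dc (x : R) : is_derive x 1 c (0 * x) by rewrite mul0r; exact: is_derive_pt_cst.
have Ds (x : R) : is_derive x 1 id (c x) by exact: is_derive_id.
have c2s2 (x : R) : c x ^+ 2 - 0 * x ^+ 2 = 1 by rewrite /c; ring.
have tanE (x : R) : tangent c id x = x by rewrite /tangent divr1.
have c0 f i j : U f -> oedge T i j -> c (d f i j) != 0 by move=> *; exact: oner_neq0.
have Dl' f i j : U f -> oedge T i j ->
    partial i (fun g => edge_length (d g) i j) f = tangent c id (d f i j).
  by move=> Uf ij; rewrite tanE; exact: Dl ij Uf.
pose W f i j := d f i j ^+ 2 - d f j i ^+ 2.
have Dd f i j k : U f -> oedge T i j ->
    is_derive f 'e_k (fun g => d g i j) (partial k (fun g => d g i j) f).
  by move=> Uf ij; exact: smooth_is_derive (sm _ _ ij) _ _ Uf.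
have DW f i j k : U f -> oedge T i j -> is_derive f 'e_k (fun g => W g i j)
    (2 * ((j == k)%:R * phi c id d f j i - (i == k)%:R * phi c id d f i j)).
  move=> Uf ij; have ji : oedge T j i by rewrite oedgeC.
  apply: is_derive_eq (is_derive_ptB (is_derive_ptM (Dd _ _ _ k Uf ij) (Dd _ _ _ k Uf ij))
    (is_derive_ptM (Dd _ _ _ k Uf ji) (Dd _ _ _ k Uf ji))) _.
  have nij := oedge_neq ij; rewrite /phi !tanE.
  have [<-|ik] := eqVneq i k; first by rewrite (eq_sym j) (negbTE nij) /=; ring.
  have [<-|jk] := eqVneq j k; first by rewrite /=; ring.
  rewrite (loc _ _ k f ij Uf) ?(loc _ _ k f ji Uf) // 1?eq_sym //.
  by rewrite /=; ring.
(* The face condition says W_ij + W_jk + W_ki = 0; its f_i-derivative is 2 ([phi]_ik - [phi]_ij). *)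
have pf f i j k : U f -> face T i j k -> phi c id d f i j = phi c id d f i k.
  move=> Uf ijk.
  have [ij _] := face_oedge ijk; have [jk _] := face_oedge (face_rot ijk).
  have [ki _] := face_oedge (face_rot (face_rot ijk)).
  have [nij njk nki] := face_third_neq ijk.
  have W0 g : U g -> 0 = W g i j + W g j k + W g k i.
    by move=> /dpl[_ H]; have := H i j k ijk; rewrite /W => E; lra.
  have := is_derive_uniq (is_derive_ptD (is_derive_ptD (DW f i j i Uf ij) (DW f j k i Uf jk))
    (DW f k i i Uf ki)) (is_derive_eq_on Uo Uf W0 (is_derive_pt_cst f 'e_i 0)).
  by rewrite eqxx (eq_sym j) (negbTE nij) (negbTE nki) /=; lra.
(* The additive counterpart of p_j V_ij^2 = p_i. *)
have phiW f i j : U f -> oedge T i j -> phi c id d f j i - phi c id d f i j = W f i j.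
  move=> Uf ij; have ji : oedge T j i by rewrite oedgeC.
  have := mixed_partials Dc Ds c2s2 Uo sm c0 Dl' Uf ij.
  have := dd_sum sm Dl' Uf ij; have := dd_sum sm Dl' Uf ji; rewrite /phi /W !tanE.
  rewrite /c !expr1n !invr1 !mul1r => Eg Ea Em.
  move: Eg Ea Em; set x := d f i j; set y := d f j i.
  set xi := partial i (fun g => d g i j) f; set yi := partial i (fun g => d g j i) f.
  set xj := partial j (fun g => d g i j) f; set yj := partial j (fun g => d g j i) f.
  move=> Eg Ea Em; have -> : yj = y - xj by rewrite -Eg; ring.
  have -> : xi = x - yi by rewrite -Ea; ring.
  by rewrite Em; ring.
have [nb nbP] := vertex_neighbor T.
have /boolp.choice[a aE] i : exists a, forall f, U f -> phi c id d f i (nb i) = a * expR (2 * f 0 i).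
  apply: (exp_solution (du := fun k f => 2 * (i == k)%:R) Uo Uc) => f k Uf.
    exact: is_derive_ptZ (is_derive_coord f i k).
  have [<-|ik] := eqVneq i k; last first.
    rewrite /= !mulr0; apply: (phi_vertex Dc Ds c2s2 Uo sm c0 loc pf Uf (nbP i)).
    by rewrite eq_sym.
  have ji : oedge T (nb i) i by rewrite oedgeC.
  have nij := oedge_neq (nbP i); have nji := nij; rewrite eq_sym in nji.
  (* The value of [phi] at the neighbor does not depend on f_i, and -W has f_i-derivative 2 [phi],
     so [phi] solves y' = 2 y. *)
  apply: (is_derive_eq_on (f := fun g => phi c id d g (nb i) i - W g i (nb i)) Uo Uf).
    by move=> g Ug; rewrite -phiW //; ring.
  have Dn := phi_vertex Dc Ds c2s2 Uo sm c0 loc pf Uf ji nij.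
  apply: is_derive_eq (is_derive_ptB Dn (DW f i (nb i) i Uf (nbP i))) _.
  by rewrite eqxx (negbTE nji) /=; ring.
(* The sign makes d_ij^2 - d_ji^2 equal to A_i - A_j. *)
pose alpha i := - a i.
have WE f i j : U f -> oedge T i j -> W f i j = vterm alpha f i - vterm alpha f j.
  move=> Uf ij; have ji : oedge T j i by rewrite oedgeC.
  rewrite -phiW // (phi_link pf Uf ij (nbP i)) (phi_link pf Uf ji (nbP j)) !aE //.
  by rewrite /vterm /alpha; ring.
have Dll f i j k : U f -> oedge T i j -> is_derive f 'e_k (fun g => edge_length (d g) i j)
    ((i == k)%:R * d f i j + (j == k)%:R * d f j i).
  move=> Uf ij; have ji : oedge T j i by rewrite oedgeC.
  apply: is_derive_eq (is_derive_ptD (Dd _ _ _ k Uf ij) (Dd _ _ _ k Uf ji)) _.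
  have nij := oedge_neq ij.
  have [<-|ik] := eqVneq i k.
    by rewrite (eq_sym j) (negbTE nij) (dd_sum sm Dl' Uf ij) tanE /=; ring.
  have [<-|jk] := eqVneq j k.
    by rewrite addrC (dd_sum sm Dl' Uf ji) tanE /=; ring.
  rewrite (loc _ _ k f ij Uf) ?(loc _ _ k f ji Uf) // 1?eq_sym //.
  by rewrite /=; ring.
have DA f i k : is_derive f 'e_k (fun g => vterm alpha g i) (2 * (i == k)%:R * vterm alpha f i).
  apply: is_derive_eq (is_derive_ptZ (alpha i)
    (is_derive_comp (g := fun g : 'rV[R]_n => 2 * g 0 i) (is_derive_expR _)
      (is_derive_ptZ 2 (is_derive_coord f i k)))) _.
  by rewrite /vterm; ring.
have etaP i j : exists e, oedge T i j -> forall f, U f ->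
    (edge_length (d f) i j ^+ 2 - vterm alpha f i - vterm alpha f j) / 2 =
    e * expR (f 0 i + f 0 j).
  have [ij|_] := boolP (oedge T i j); last by exists 0.
  suff [e eE] : exists e, forall f, U f ->
    (edge_length (d f) i j ^+ 2 - vterm alpha f i - vterm alpha f j) / 2 =
    e * expR (f 0 i + f 0 j) by exists e.
  apply: (exp_solution (du := fun k f => (i == k)%:R + (j == k)%:R) Uo Uc) => f k Uf.
    exact: is_derive_ptD (is_derive_coord f i k) (is_derive_coord f j k).
  have Dl2 := is_derive_ptM (Dll _ _ _ k Uf ij) (Dll _ _ _ k Uf ij).
  apply: is_derive_eq (is_derive_ptM (is_derive_ptB (is_derive_ptB Dl2 (DA f i k)) (DA f j k))
    (is_derive_pt_cst f 'e_k 2^-1)) _.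
  (* From 2 l d_ij = l^2 + d_ij^2 - d_ji^2 = l^2 + A_i - A_j, the quantity (l^2 - A_i - A_j) / 2 has
     logarithmic derivative 1 in f_i; likewise in f_j. *)
  have := WE f i j Uf ij; rewrite /W /edge_length.
  set x := d f i j; set y := d f j i; set A := vterm _ _ _; set B := vterm _ _ _ => E.
  have -> : A = x ^+ 2 - y ^+ 2 + B by rewrite E; ring.
  by field.
have [eta etaE] := boolp.choice (fun ij : 'I_n * 'I_n => etaP ij.1 ij.2).
have [[f0 Uf0]|U0] := pselect (exists f, U f); last first.
  exists alpha, (fun _ _ => 0); split => // f i j Uf.
  by case: U0; exists f.
exists alpha, (fun i j => eta (i, j)); split.
  move=> i j ij; apply: (mulIf (lt0r_neq0 (expR_gt0 (f0 0 i + f0 0 j)))).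
  have ji : oedge T j i by rewrite oedgeC.
  have /= Ei := etaE (i, j) ij _ Uf0; have /= Ej := etaE (j, i) ji _ Uf0.
  rewrite (addrC (f0 0 j)) in Ej; rewrite -Ei -Ej /edge_length; ring.
move=> f i j Uf ij.
have l0 := lt0r_neq0 (partial_edge_lengths_gt0 (dpl f Uf) ij).
rewrite /formA /eterm -(etaE (i, j) ij f Uf) /=.
split; last by field.
have := WE f i j Uf ij; move: l0; rewrite /W /edge_length.
set x := d f i j; set y := d f j i; set A := vterm _ _ _; set B := vterm _ _ _ => l0 E.
have -> : A = x ^+ 2 - y ^+ 2 + B by rewrite E; ring.
by field.
Qed.

End EuclideanCase.

Unset Implicit Arguments.

(** Connectedness of U makes alpha, eta and C single constants rather than constants on each
    component. *)
Theorem theorem1p3 (R : realType) (n : nat) (T : triangulated_closed_surface n)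
    (G : geometry) (U : set 'rV[R]_n) (d : 'rV[R]_n -> 'I_n -> 'I_n -> R)
    (U_connected : connected U)
    (d_dcs : discrete_conformal_structure G T U d) :
  exists (alpha : 'I_n -> R) (eta : 'I_n -> 'I_n -> R),
    (forall i j, oedge T i j -> eta i j = eta j i) /\
    match G with
    | Euclidean =>
        forall f i j, U f -> oedge T i j -> formA alpha eta d f i j
    | Hyperbolic =>
        (forall f i j, U f -> oedge T i j -> formB1 alpha eta d f i j) \/
        (exists C : 'I_n -> 'I_n -> R, triangle_constants T C /\
          forall f i j, U f -> oedge T i j -> formB2 eta C d f i j)
    | Spherical =>
        ((forall f i j, U f -> oedge T i j -> same_sign_edge d f i j ->
            formC1 alpha eta d f i j) \/
         (exists C : 'I_n -> 'I_n -> R, triangle_constants T C /\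
            forall f i j, U f -> oedge T i j -> same_sign_edge d f i j ->
              formC2 eta C d f i j)) /\
        ((forall f i j, U f -> oedge T i j -> opposite_sign_edge d f i j ->
            formC3 alpha eta d f i j) \/
         (exists C : 'I_n -> 'I_n -> R, triangle_constants T C /\
            forall f i j, U f -> oedge T i j -> opposite_sign_edge d f i j ->
              formC4 eta C d f i j))
    end.
Proof.
case: G d_dcs => dcs.
- exact: euclidean_forms U_connected dcs.
- exact: hyperbolic_forms U_connected dcs.
- have [alpha [eta [eta_sym H]]] := spherical_forms U_connected dcs.
  (* One dichotomy governs both sign classes: (c1) occurs with (c3), and (c2) with (c4). *)
  exists alpha, eta; split=> //; case: H => [H|[C [HC H]]].
    by split; left => f i j Uf ij; case: (H f i j Uf ij).
  by split; right; exists C; split=> // f i j Uf ij; case: (H f i j Uf ij).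
Qed.
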